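(* Let $V$ be a faithful uniserial $\mathfrak g$-module of length $3$ whose socle factors are $V(a),V(b),V(c)$ (in this order, from the bottom). Then $c=a$. Moreover: (i) if $m=1$, then either $b=a+1$, or $a\ge1$ and $b=a-1$; (ii) if $m\ge3$, then either $(a,b)=(0,m)$, or $(a,b)=(1,m+1)$, or $(a,b)=(1,m-1)$, or $m=3$ and $(a,b)=(4,3)$. Furthermore, in all cases the isomorphism class of $V$ is completely determined by the sequence of its socle factors.
   Context: $\mathbb F$ is a field of characteristic zero; all Lie algebras and modules are finite dimensional over $\mathbb F$. For an integer $a\ge0$, $V(a)$ denotes the irreducible $\mathfrak{sl}(2)$-module of highest weight $a$. $\mathfrak h_n$ ($n\ge1$) is the Heisenberg Lie algebra of dimension $2n+1$, with one-dimensional center $\mathfrak z=\mathbb F z$ and $[\mathfrak h_n,\mathfrak h_n]=\mathfrak z$; $m=2n-1$. $\mathfrak{sl}(2)$ acts on $\mathfrak h_n$ by derivations so that $\mathfrak h_n\cong V(m)\oplus\mathfrak z$ as $\mathfrak{sl}(2)$-modules, with $\mathfrak z\cong V(0)$ (the bracket on $V(m)$ being the unique, up to scaling, nonzero $\mathfrak{sl}(2)$-invariant skew form with values in $\mathfrak z$). $\mathfrak g=\mathfrak{sl}(2)\ltimes\mathfrak h_n$. For a $\mathfrak g$-module $V$, the socle series $0=\mathrm{soc}^0(V)\subset\cdots\subset\mathrm{soc}^\ell(V)=V$ is defined by letting $\mathrm{soc}^i(V)/\mathrm{soc}^{i-1}(V)$ be the socle of $V/\mathrm{soc}^{i-1}(V)$;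 $V$ is uniserial of length $\ell$ if all these socle factors are irreducible. Socle factors of uniserial $\mathfrak g$-modules are irreducible modules on which $\mathfrak h_n$ acts trivially, identified with some $V(a)$. Faithful means the representation is injective. *)

(* Defs.v *)
From HB Require Import structures.
From mathcomp Require Import all_boot all_order all_algebra.
Set Implicit Arguments. Unset Strict Implicit. Unset Printing Implicit Defensive.
Import GRing.Theory.
Local Open Scope ring_scope.

Section Defs.
Variable F : fieldType.

(* ---------- the irreducible sl(2)-module V(k), realised on row vectors of
   size dim (= k+1), basis u_0..u_k, with
     e.u_i = i(k-i+1) u_(i-1),  f.u_i = u_(i+1),  h.u_i = (k-2i) u_i.
   Convention: x.v := v *m M_x (row i of M_x is x.u_i). *)
Definition sl2E (k dim : nat) : 'M[F]_dim :=
  \matrix_(i, j) (if ((j : nat).+1 == (i : nat))%N then ((i : nat) * (k - i).+1)%:R else 0).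
Definition sl2F (dim : nat) : 'M[F]_dim :=
  \matrix_(i, j) (if ((j : nat) == (i : nat).+1)%N then 1 else 0).
Definition sl2H (k dim : nat) : 'M[F]_dim :=
  \matrix_(i, j) (if i == j then k%:R - (2 * i)%:R else 0).

(* ---------- g = sl(2) |x h_n, elements  x = ge e + gf f + gh h + v + gz z,
   v in V(m) (dimension 2n, m = 2n-1), z central. *)
Definition mH (n : nat) : nat := (n.*2).-1.

Record gelt (n : nat) := GElt {
  ge : F; gf : F; gh : F; gv : 'rV[F]_(n.*2); gz : F }.

Definition sl2act n (x : gelt n) : 'M[F]_(n.*2) :=
  ge x *: sl2E (mH n) (n.*2) + gf x *: sl2F (n.*2) + gh x *: sl2H (mH n) (n.*2).

(* the (unique up to scalar) sl(2)-invariant skew form on V(m) *)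
Definition omega n (v w : 'rV[F]_(n.*2)) : F :=
  \sum_(i < n.*2) \sum_(j < n.*2)
     (if ((i : nat) + j == mH n)%N then (-1) ^+ i * v 0 i * w 0 j else 0).

(* Lie bracket of g:  [e,f]=h, [h,e]=2e, [h,f]=-2f, [s,v]=s.v, [v,w]=omega(v,w) z *)
Definition gbr n (x y : gelt n) : gelt n :=
  GElt (2 * (gh x * ge y - ge x * gh y))
       (2 * (gf x * gh y - gh x * gf y))
       (ge x * gf y - gf x * ge y)
       (gv y *m sl2act x - gv x *m sl2act y)
       (omega (gv x) (gv y)).

(* ---------- a (candidate) representation of g on F^d: images of the basis
   e, f, h, v_0..v_(2n-1), z; rho is its linear extension. *)
Record grep (n d : nat) := GRep {
  rE : 'M[F]_d; rF : 'M[F]_d; rH : 'M[F]_d;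
  rX : 'I_(n.*2) -> 'M[F]_d; rZ : 'M[F]_d }.

Definition rho n d (R : grep n d) (x : gelt n) : 'M[F]_d :=
  ge x *: rE R + gf x *: rF R + gh x *: rH R
  + \sum_(i < n.*2) gv x 0 i *: rX R i + gz x *: rZ R.

(* x.v := v *m rho x ; module axiom  [x,y].v = x.(y.v) - y.(x.v) *)
Definition is_gmod n d (R : grep n d) : Prop :=
  forall (x y : gelt n) (v : 'rV[F]_d),
    v *m rho R (gbr x y) = v *m rho R y *m rho R x - v *m rho R x *m rho R y.

Definition faithful n d (R : grep n d) : Prop := injective (rho R).

Definition submod n d (R : grep n d) (U : 'M[F]_d) : Prop :=
  forall x : gelt n, (U *m rho R x <= U)%MS.

Definition simple_over n d (R : grep n d) (U W : 'M[F]_d) : Prop :=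
  [/\ submod R W, (U < W)%MS &
      forall W' : 'M[F]_d, submod R W' -> (U <= W')%MS -> (W' <= W)%MS ->
        (W' == U)%MS \/ (W' == W)%MS].

Definition is_soc_over n d (R : grep n d) (U S : 'M[F]_d) : Prop :=
  (forall W, simple_over R U W -> (W <= S)%MS) /\
  exists k (Ws : 'I_k -> 'M[F]_d),
    (forall i, simple_over R U (Ws i)) /\ (S == U + \sum_(i < k) Ws i)%MS.

Definition vrep n (a : nat) (x : gelt n) : 'M[F]_a.+1 :=
  ge x *: sl2E a a.+1 + gf x *: sl2F a.+1 + gh x *: sl2H a a.+1.

Definition factor_iso n d (R : grep n d) (U W : 'M[F]_d) (a : nat) : Prop :=
  exists phi : 'M[F]_(d, a.+1),
    [/\ row_full (W *m phi),
        forall v : 'rV[F]_d, (v <= W)%MS -> (v *m phi == 0) = (v <= U)%MS &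
        forall (x : gelt n) (v : 'rV[F]_d), (v <= W)%MS ->
          v *m rho R x *m phi = v *m phi *m vrep a x].

Definition uniserial3 n d (R : grep n d) (a b c : nat) : Prop :=
  exists S1 S2 : 'M[F]_d,
    [/\ is_soc_over R 0 S1, is_soc_over R S1 S2 & is_soc_over R S2 1%:M] /\
    [/\ factor_iso R 0 S1 a, factor_iso R S1 S2 b & factor_iso R S2 1%:M c].

Definition gmod_iso n d d' (R : grep n d) (R' : grep n d') : Prop :=
  exists P : 'M[F]_(d, d'),
    [/\ row_free P, row_full P & forall x : gelt n, rho R x *m P = P *m rho R' x].

End Defs.

(* Main.v *)
(* Let m = 2n - 1. By complete reducibility over sl(2), V = V(a) + V(b) + V(c), and
   h_n acts by sl(2)-maps V(m) (x) V(c) -> V(b) and V(m) (x) V(b) -> V(a), given by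
   families be_i and al_i, together with V(m) (x) V(c) -> V(a). The center maps V(c)
   to V(a) by an sl(2)-map, nonzero by faithfulness, hence c = a; the third family
   then vanishes because m is odd, and al, be are unique up to scalars, which gives
   uniqueness of V.
   Write b = m + a - 2k and r = a - k. Evaluating the commutator of v_(m-i) and v_i
   on the highest weight vector of V(c) shows that q(i) + q(m - i) does not depend on
   0 <= i <= m, where q(i) is the product of the falling factorials i^_k and
   (m-i+r)^_r. For m >= 3 the values at i = 0, 1, 2 leave only the listed cases. *)

(* Complete reducibility enters as one statement: a surjection from an sl(2)-stable space onto V(k)
   has an equivariant section. It suffices to lift the highest weight vector of V(k) to an exact
   highest weight vector, and the identities between powers of e and f do this once e is nilpotent.
   That e is nilpotent on V is read off from the three socle factors.

   The polynomial q comes from the equation that e imposes on the images v_i u_0 in V(b): a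
   first-order recurrence, solved by products of falling factorials. On the way back to the highest
   weight vector of V(a), weights leave one intermediate basis vector. A commutator produces a sum
   of two values of q, and not a difference, because m is odd. For m = 1 the condition on q is
   empty, and only the bounds k <= m and k <= a remain.

   Operators act on row vectors from the right, so products of matrices read in the order opposite
   to composition. *)
Require Import Defs.
From HB Require Import structures.
From mathcomp Require Import all_boot all_order all_algebra.
From mathcomp Require Import zify ring.
Set Implicit Arguments. Unset Strict Implicit. Unset Printing Implicit Defensive.

(** * Sums of products of falling factorials *)

(* Up to sign and a factor independent of i, the scalar by which v_(m-i) v_i acts
   on the highest weight vector of V(k+r) through V(m+r-k), where v_i maps V(k+r)
   to V(m+r-k) and v_(m-i) maps it back. *)
Definition diag_weight (m k r i : nat) : nat := i ^_ k * (m - i + r) ^_ r.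

(** The discrete derivative of the falling factorial, from which monotonicity and convexity are
    drawn. *)
Lemma ffactS_diff x t : x.+1 ^_ t.+1 = x ^_ t.+1 + t.+1 * x ^_ t.
Proof.
rewrite ffactSS ffactnSr; case: (leqP t x) => [le_tx|lt_xt].
  by rewrite [t.+1 * _]mulnC -mulnDr mulnC; congr (_ * _); lia.
by rewrite ffact_small // !muln0.
Qed.

Lemma ffact_mono t : {homo (fun x => x ^_ t) : x y / x <= y}.
Proof.
move=> x y le_xy; rewrite -(subnKC le_xy); elim: (y - x) => [|z IHz].
  by rewrite addn0.
apply: leq_trans IHz _; rewrite addnS; case: t => // t.
by rewrite ffactS_diff leq_addr.
Qed.

Lemma ffact_smono t x y : x < y -> t <= x -> x ^_ t.+1 < y ^_ t.+1.
Proof.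
move=> lt_xy le_tx; apply: leq_trans (ffact_mono _ lt_xy).
by rewrite ffactS_diff -addn1 leq_add2l muln_gt0 ffact_gt0.
Qed.

(** If k = 0 or r = 0, one factor of the weight is 1, and convexity or strict monotonicity of the
    other decides. If both are positive, the weight vanishes at 0, for k >= 2 also at 1, and for k
    >= 3 also at 2. The equations then compare single products of falling factorials, and cancelling
    leaves low-degree relations between m, k and r. *)
Lemma diag_weight_sum_const m k r : odd m -> 3 <= m -> k <= m ->
  (forall i, i <= m ->
     diag_weight m k r i + diag_weight m k r (m - i) =
     diag_weight m k r m + diag_weight m k r 0) ->
  [\/ k = 0 /\ r = 0, k = 0 /\ r = 1, k = 1 /\ r = 0 | [/\ m = 3, k = 2 & r = 2]].
Proof.
move=> m_odd m_ge3 le_km eqw.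
have e1 := eqw 1 (ltnW (ltnW m_ge3)).
have {eqw}e2 := eqw 2 (ltnW m_ge3).
have s1 : m - (m - 1) = 1 by lia.
have s2 : m - (m - 2) = 2 by lia.
rewrite /diag_weight subn0 subnn add0n s1 in e1.
rewrite /diag_weight subn0 subnn add0n s2 in e2.
have [k0|k_gt0] := posnP k.
  subst k; move: e1; rewrite !ffactn0 !mul1n => e1.
  case: r e1 {e2} => [|[|r]] e1; [by constructor 1|by constructor 2|exfalso].
  (* Strict convexity in degree at least 2: the increment at m - 1 + r exceeds the increment at r,
     although [e1] makes them equal. *)
  have := ffactS_diff (m - 1 + r.+2) r.+1; have := ffactS_diff r.+2 r.+1.
  have -> : (m - 1 + r.+2).+1 = m + r.+2 by lia.
  have : r.+2 ^_ r.+1 < (m - 1 + r.+2) ^_ r.+1.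
    by apply: ffact_smono; lia.
  rewrite -(ltn_pmul2l (ltn0Sn r.+1)); move: e1; rewrite add1n.
  set a1 := _ ^_ _; set a2 := _ ^_ _; set a3 := _ ^_ _; set a4 := _ ^_ _.
  by lia.
have [r0|r_gt0] := posnP r.
  subst r; move: e1 {e2}; rewrite !ffactn0 !muln1 (@ffact_small 0) // addn0.
  case: k k_gt0 le_km => [|[|k]] // _ le_km; first by constructor 3.
  rewrite (@ffact_small 1) // add0n => e1; exfalso.
  have : (m - 1) ^_ k.+2 < m ^_ k.+2 by apply: ffact_smono; lia.
  by lia.
rewrite (@ffact_small 0 k) // mul0n addn0 ffactnn in e1 e2.
have fr : (1 + r) ^_ r = r.+1 * r`!.
  by rewrite add1n -factS -(@ffact_fact r.+1 r) ?leqnSn // subSnn muln1.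
rewrite fr in e1.
have [k1|k_ne1] := eqVneq k 1.
  subst k; exfalso; move: e1; rewrite !ffactn1 mul1n.
  have : 0 < (m - 1 + r) ^_ r by rewrite ffact_gt0; lia.
  have : 0 < r`! by exact: fact_gt0.
  move: (r`!) (_ ^_ _) => f g f0 g0; rewrite mulnA => e.
  have : m * f <= (m - 1) * r.+1 * f by rewrite leq_mul2r; nia.
  by lia.
case: k k_gt0 k_ne1 le_km e1 e2 => [|[|k]] // _ _ le_km e1 e2.
have e1' : m = (m - k.+2) * r.+1.
  have := e1; rewrite (@ffact_small 1) // mul0n add0n.
  have defm : m = (m - 1).+1 by lia.
  rewrite {2}defm ffactSS ffactnSr -defm.
  have -> : m - 1 - k.+1 = m - k.+2 by lia.
  have : 0 < (m - 1) ^_ k.+1 by rewrite ffact_gt0; lia.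
  have : 0 < r`! by exact: fact_gt0.
  move: (r`!) (_ ^_ _) => f g f0 g0 e.
  apply/eqP; rewrite -(@eqn_pmul2l (g * f)) ?muln_gt0 ?f0 ?g0 //.
  by apply/eqP; lia.
case: k le_km e1 e2 e1' => [|k] le_km e1 e2 e1'.
  (* Here m - 2 divides m, hence divides 2, and m is odd. *)
  constructor 4; have m3 : m = 3 by nia.
  by subst m; split => //; lia.
exfalso.
have : 2 * (m - 1) = (m - 1 - k.+3) * r.+2.
  have := e2; rewrite (@ffact_small 2) // mul0n add0n -e1.
  rewrite (@ffact_small 1) // mul0n add0n.
  have defm : m - 1 = (m - 2).+1 by lia.
  have fr2 : 2 * (2 + r) ^_ r = r.+2 * (r.+1 * r`!).
    have r2 : r.+2 - r = 2 by lia.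
    by rewrite -!factS -(@ffact_fact r.+2 r) ?leqW // r2 mulnC.
  rewrite {1}defm ffactSS ffactnSr -defm.
  have -> : m - 2 - k.+2 = m - 1 - k.+3 by lia.
  have : 0 < (m - 2) ^_ k.+2 by rewrite ffact_gt0; nia.
  have : 0 < r`! by exact: fact_gt0.
  move: fr2; move: (r`!) (_ ^_ _) (_ ^_ _) => f g h gf f0 g0 e.
  have p : 0 < r.+1 * g * f by rewrite !muln_gt0 f0 g0.
  by apply/eqP; rewrite -(eqn_pmul2l p); apply/eqP; nia.
(* With s = m - [k.+3], [e1'] reads m = s (r + 1) and the new relation 2 (m - 1) = (s - 1)(r + 2);
   eliminating m gives (s + 1) r = 0. *)
by nia.
Qed.

Import GRing.Theory.
Local Open Scope ring_scope.

(** * The matrices of the irreducible sl(2)-modules *)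

Section NatIndexed.
Variable F : fieldType.

(* Rows and entries are accessed by natural numbers, with value 0 out of range, so
   that the formulas for the sl(2)-action hold without side conditions. *)
Definition rown p q (A : 'M[F]_(p.+1, q)) (i : nat) : 'rV[F]_q :=
  if (i <= p)%N then row (inord i) A else 0.

Definition ent p q (A : 'M[F]_(p.+1, q.+1)) (i j : nat) : F :=
  if (j <= q)%N then rown A i 0 (inord j) else 0.

Lemma rown_ord p q (A : 'M[F]_(p.+1, q)) (i : 'I_p.+1) : rown A i = row i A.
Proof. by rewrite /rown -ltnS ltn_ord inord_val. Qed.

Lemma rownP p q (A B : 'M[F]_(p.+1, q)) :
  (forall i, rown A i = rown B i) -> A = B.
Proof. by move=> eqAB; apply/row_matrixP => i; rewrite -!rown_ord. Qed.

Lemma ent_ord p q (A : 'M[F]_(p.+1, q.+1)) (i : 'I_p.+1) (j : 'I_q.+1) :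
  ent A i j = A i j.
Proof. by rewrite /ent -ltnS ltn_ord inord_val rown_ord mxE. Qed.

Lemma entP p q (A B : 'M[F]_(p.+1, q.+1)) :
  (forall i j, ent A i j = ent B i j) -> A = B.
Proof. by move=> eqAB; apply/matrixP => i j; rewrite -!ent_ord. Qed.

Lemma rown_mul p q r (A : 'M[F]_(p.+1, q)) (B : 'M[F]_(q, r)) i :
  rown (A *m B) i = rown A i *m B.
Proof. by rewrite /rown; case: ifP => _; rewrite ?row_mul ?mul0mx. Qed.

Fact rown_is_linear p q i : linear (fun A : 'M[F]_(p.+1, q) => rown A i).
Proof.
move=> k A B; rewrite /rown; case: ifP => _; first exact: linearP.
by rewrite scaler0 addr0.
Qed.

Lemma rownD p q (A B : 'M[F]_(p.+1, q)) i : rown (A + B) i = rown A i + rown B i.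
Proof. by have := rown_is_linear i 1 A B; rewrite !scale1r. Qed.

Lemma entD p q (A B : 'M[F]_(p.+1, q.+1)) i j :
  ent (A + B) i j = ent A i j + ent B i j.
Proof. by rewrite /ent; case: ifP => _; rewrite ?rownD ?mxE ?addr0. Qed.

Lemma entZ p q c (A : 'M[F]_(p.+1, q.+1)) i j : ent (c *: A) i j = c * ent A i j.
Proof.
by rewrite /ent /rown; do 2?case: ifP => _; rewrite ?mxE ?mulr0.
Qed.

Lemma ent0 p q i j : ent (0 : 'M[F]_(p.+1, q.+1)) i j = 0.
Proof. by rewrite /ent /rown; do 2?case: ifP => _; rewrite ?mxE. Qed.

Lemma ent_out p q (A : 'M[F]_(p.+1, q.+1)) i j :
  (p < i)%N || (q < j)%N -> ent A i j = 0.
Proof.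
rewrite /ent /rown; case: (leqP j q) => // _; case: (leqP i p) => //= _ _.
by rewrite mxE.
Qed.

Lemma rown_sl2E k q (A : 'M[F]_(k.+1, q)) i :
  rown (sl2E F k k.+1 *m A) i = (i * (k.+1 - i))%:R *: rown A i.-1.
Proof.
rewrite rown_mul; case: (leqP i k) => [le_ik|lt_ki]; last first.
  rewrite /rown leqNgt lt_ki mul0mx /=.
  by have -> : (k.+1 - i = 0)%N by [apply/eqP; rewrite subn_eq0]; rewrite muln0 scale0r.
case: i le_ik => [|i] le_ik.
  rewrite mul0n scale0r /rown /= [X in X *m _](_ : _ = 0) ?mul0mx //.
  by apply/rowP => j; rewrite !mxE inordK.
rewrite /rown le_ik ltnW //= [row _ (sl2E _ _ _)](_ : _ =
    (i.+1 * (k.+1 - i.+1))%:R *: delta_mx 0 (inord i)).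
  by rewrite -scalemxAl -rowE.
apply/rowP => j; rewrite !mxE /= inordK ?ltnS // -val_eqE /= inordK ?ltnS ?(ltnW le_ik) //.
rewrite eqSS; case: eqP => _; rewrite ?mulr0 // mulr1.
by congr (_ * _)%:R; lia.
Qed.

Lemma rown_sl2F k q (A : 'M[F]_(k.+1, q)) i :
  rown (sl2F F k.+1 *m A) i = rown A i.+1.
Proof.
rewrite rown_mul; case: (leqP i k) => [le_ik|lt_ki]; last first.
  by rewrite /rown leqNgt lt_ki leqNgt ltnS ltnW //= mul0mx.
rewrite /rown le_ik; case: ltnP => lt_ik.
  rewrite (rowE _ A); congr (_ *m _); apply/rowP => j; rewrite !mxE /=.
  by rewrite -val_eqE /= !inordK //; case: eqP.
rewrite [X in X *m _](_ : _ = 0) ?mul0mx //; apply/rowP => j; rewrite !mxE.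
rewrite inordK //; case: eqP => // ji; have := ltn_ord j.
by rewrite ji ltnS ltnNge lt_ik.
Qed.

Lemma rown_sl2H k q (A : 'M[F]_(k.+1, q)) i :
  rown (sl2H F k k.+1 *m A) i = (k%:R - (2 * i)%:R) *: rown A i.
Proof.
rewrite rown_mul /rown; case: leqP => le_ik; last by rewrite mul0mx scaler0.
rewrite [X in X *m _](_ : _ = (k%:R - (2 * i)%:R) *: delta_mx 0 (inord i)).
  by rewrite -scalemxAl -rowE.
apply/rowP => j; rewrite !mxE /= -val_eqE -[in RHS]val_eqE /= inordK //.
by rewrite eq_sym; case: eqP; rewrite ?mulr1 ?mulr0.
Qed.

Lemma ent_sl2E_l k q (A : 'M[F]_(k.+1, q.+1)) i j :
  ent (sl2E F k k.+1 *m A) i j = (i * (k.+1 - i))%:R * ent A i.-1 j.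
Proof. by rewrite /ent; case: ifP => _; rewrite ?mulr0 // rown_sl2E mxE. Qed.

Lemma ent_sl2F_l k q (A : 'M[F]_(k.+1, q.+1)) i j :
  ent (sl2F F k.+1 *m A) i j = ent A i.+1 j.
Proof. by rewrite /ent; case: ifP => _; rewrite ?mulr0 // rown_sl2F. Qed.

Lemma ent_sl2H_l k q (A : 'M[F]_(k.+1, q.+1)) i j :
  ent (sl2H F k k.+1 *m A) i j = (k%:R - (2 * i)%:R) * ent A i j.
Proof. by rewrite /ent; case: ifP => _; rewrite ?mulr0 // rown_sl2H mxE. Qed.

Lemma ent_sl2E_r p k (A : 'M[F]_(p.+1, k.+1)) i j :
  ent (A *m sl2E F k k.+1) i j = (j.+1 * (k - j))%:R * ent A i j.+1.
Proof.
rewrite /ent rown_mul; case: (leqP j k) => [le_jk|lt_kj]; last first.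
  by rewrite ltnNge (ltnW lt_kj) /= mulr0.
rewrite mxE; case: ltnP => lt_jk; last first.
  rewrite mulr0 big1 // => t _; rewrite !mxE inordK //; case: eqP => [jt|_].
    by have := ltn_ord t; rewrite -jt ltnS ltnNge lt_jk.
  by rewrite mulr0.
rewrite (bigD1 (inord j.+1)) //= big1 ?addr0 => [|t]; last first.
  rewrite -val_eqE /= inordK // !mxE inordK // eq_sym => /negPf->.
  by rewrite mulr0.
rewrite [sl2E _ _ _ _ _]mxE !inordK // eqxx mulrC; congr (_%:R * _).
by congr (_ * _)%N; lia.
Qed.

Lemma ent_sl2F_r0 p k (A : 'M[F]_(p.+1, k.+1)) i :
  ent (A *m sl2F F k.+1) i 0 = 0.
Proof.
rewrite /ent rown_mul /= mxE big1 // => t _; rewrite !mxE inordK //=.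
by rewrite mulr0.
Qed.

Lemma ent_sl2F_rS p k (A : 'M[F]_(p.+1, k.+1)) i j : (j < k)%N ->
  ent (A *m sl2F F k.+1) i j.+1 = ent A i j.
Proof.
move=> lt_jk; rewrite /ent rown_mul lt_jk (ltnW lt_jk) mxE.
rewrite (bigD1 (inord j)) //= big1 ?addr0 => [|t]; last first.
  rewrite -val_eqE /= inordK ?ltnS ?(ltnW lt_jk) // !mxE inordK // eqSS eq_sym.
  by move=> /negPf->; rewrite mulr0.
by rewrite [sl2F _ _ _ _]mxE !inordK ?ltnS ?(ltnW lt_jk) // eqxx mulr1.
Qed.

Lemma ent_sl2H_r p k (A : 'M[F]_(p.+1, k.+1)) i j :
  ent (A *m sl2H F k k.+1) i j = (k%:R - (2 * j)%:R) * ent A i j.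
Proof.
rewrite /ent rown_mul; case: (leqP j k) => [le_jk|_]; last by rewrite mulr0.
rewrite mxE (bigD1 (inord j)) //= big1 ?addr0 => [|t /negPf tj]; last first.
  by rewrite !mxE tj mulr0.
by rewrite [sl2H _ _ _ _ _]mxE eqxx inordK // mulrC.
Qed.

Lemma ent_mul p q r (A : 'M[F]_(p.+1, q.+1)) (B : 'M[F]_(q.+1, r.+1)) i j :
  ent (A *m B) i j = \sum_(t < q.+1) ent A i t * ent B t j.
Proof.
rewrite /ent rown_mul; case: ifP => jr; last first.
  by rewrite big1 // => t _; rewrite mulr0.
rewrite mxE; apply: eq_bigr => t _.
by rewrite -ltnS ltn_ord inord_val rown_ord mxE.
Qed.

(** Column j of a product with E on the right is a multiple of column j + 1 of the other factor, so
    t factors push column j out of range as soon as j + t > k. *)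
Lemma sl2E_expn k : (sl2E F k k.+1) ^+ k.+1 = 0.
Proof.
suff nil t i j : (k < j + t)%N -> ent (sl2E F k k.+1 ^+ t) i j = 0.
  by apply: entP => i j; rewrite nil ?ent0 // addnS ltnS leq_addl.
elim: t i j => [|t IHt] i j lt_k.
  by rewrite ent_out // -[j]addn0 lt_k orbT.
rewrite exprSr -mulmxE ent_sl2E_r; case: (ltnP j k) => [lt_jk|le_kj].
  by rewrite IHt ?mulr0 // addSnnS.
by have /eqP-> : (k - j == 0)%N; rewrite ?subn_eq0 // muln0 mul0r.
Qed.

End NatIndexed.

(** * Complete reducibility *)

Section Sl2Triple.
Variables (F : fieldType) (charF0 : [pchar F] =i pred0).
Variables (d : nat) (E G H : 'M[F]_d.+1).
Hypotheses (GE : G * E - E * G = H) (EH : E * H = H * E + E *+ 2)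
  (GH : G * H = H * G - G *+ 2).

Lemma natrF_eq0 (i : nat) : (i%:R == 0 :> F) = (i == 0)%N.
Proof. by move/pcharf0P: charF0 => ->. Qed.

Lemma natrF_inj (i j : nat) : i%:R = j%:R :> F -> i = j.
Proof.
wlog le_ij : i j / (i <= j)%N.
  by move=> wl; case/orP: (leq_total i j) => le e; [|symmetry]; exact: wl.
move=> eij; have /eqP : (j - i)%:R = 0 :> F by rewrite natrB // eij subrr.
by rewrite natrF_eq0 subn_eq0 => le_ji; apply/eqP; rewrite eqn_leq le_ij.
Qed.

(** The enveloping algebra identity for e f^(k+1). H stands to the left of the powers of G, so that
    it meets a row vector first. *)
Lemma expG_E k :
  G ^+ k.+1 * E = E * G ^+ k.+1 + ((H - k%:R) * G ^+ k) *+ k.+1.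
Proof.
elim: k => [|k IHk].
  by rewrite subr0 expr0 mulr1 expr1 mulr1n -GE addrC subrK.
rewrite exprS -mulrA IHk mulrDr mulrA.
have -> : G * E = E * G + H by rewrite -GE addrC subrK.
rewrite mulrDl -mulrA -exprS -addrA; congr (_ + _).
rewrite mulrnAr mulrA mulrBr GH -mulr_natr.
have -> : H * G - G *+ 2 - G * k%:R = (H - k.+2%:R) * G.
  rewrite mulrBl !mulr_natl mulr_natr -addrA -opprD -mulrnDr.
  by congr (_ - G *+ _).
rewrite -(mulrA (H - _)) -exprS mulr_natr -mulrnAl -mulrDl -[RHS]mulrnAl.
congr (_ * _); rewrite !mulrnBl addrA -mulrS; congr (_ - _).
by rewrite -!mulrnA mulnC.
Qed.

Lemma H_expG k : H * G ^+ k = G ^+ k * (H + (2 * k)%:R).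
Proof.
elim: k => [|k IHk]; first by rewrite muln0 addr0 mulr1 mul1r.
rewrite exprSr mulrA IHk -!mulrA mulrDl.
have -> : H * G = G * H + G *+ 2 by rewrite GH subrK.
congr (_ * _); rewrite mulr_natl -addrA -mulrnDr mulrDr mulr_natr.
by congr (_ + G *+ _); lia.
Qed.

Lemma E_expG k :
  E * G ^+ k.+1 = G ^+ k.+1 * E - (G ^+ k * (H + k%:R)) *+ k.+1.
Proof.
have -> : G ^+ k * (H + k%:R) = (H - k%:R) * G ^+ k.
  rewrite mulrBl H_expG mulr_natl !mulrDr !mulr_natr -addrA; congr (_ + _).
  by rewrite mul2n -addnn mulrnDr addrK.
by rewrite expG_E addrK.
Qed.

Lemma natr_mx (k : nat) : k%:R = k%:R%:M :> 'M[F]_d.+1.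
Proof. by rewrite -[RHS]scalemx1 scaler_nat. Qed.

Lemma mulmx_nat p (v : 'M[F]_(p, d.+1)) (k : nat) :
  v *m (k%:R : 'M_d.+1) = v *+ k.
Proof. by rewrite natr_mx mul_mx_scalar scaler_nat. Qed.

Lemma mulmxMn p q r (A : 'M[F]_(p, q)) (B : 'M[F]_(q, r)) k :
  A *m (B *+ k) = (A *m B) *+ k.
Proof. by rewrite -!scaler_nat -scalemxAr. Qed.

Lemma mulMnmx p q r (A : 'M[F]_(p, q)) (B : 'M[F]_(q, r)) k :
  (A *+ k) *m B = (A *m B) *+ k.
Proof. by rewrite -!scaler_nat -scalemxAl. Qed.

Lemma killedE_H p (v : 'M_(p, d.+1)) : v *m E = 0 -> v *m H *m E = 0.
Proof.
move=> vE; have -> : v *m H *m E = v *m (E * H - E *+ 2).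
  by rewrite EH addrK -mulmxA.
by rewrite mulmxBr mulmxMn -mulmxE mulmxA vE mul0mx mul0rn subr0.
Qed.

Definition weight_poly (k : nat) : {poly F} := \prod_(i < k) ('X - i%:R%:P).

Lemma horner_mxXB (x : F) : horner_mx H ('X - x%:P) = H - x%:M.
Proof. by rewrite raddfB /= horner_mx_X horner_mx_C. Qed.

(* Since E is nilpotent, H is thus annihilated on ker E by a polynomial with
   simple natural roots: this replaces the semisimplicity of H. *)
Lemma killedE_weights k :
  exists2 c : F, c != 0 & forall v : 'rV_d.+1, v *m E = 0 ->
  v *m (G ^+ k * E ^+ k) = c *: (v *m horner_mx H (weight_poly k)).
Proof.
elim: k => [|k [c c0 IHk]].
  exists 1; first exact: oner_neq0.
  by move=> v _; rewrite /weight_poly big_ord0 rmorph1 mul1r scale1r.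
exists (c * k.+1%:R) => [|v vE]; first by rewrite mulf_neq0 // natrF_eq0.
have -> : v *m (G ^+ k.+1 * E ^+ k.+1)
    = (v *m (H - k%:R) *m (G ^+ k * E ^+ k)) *+ k.+1.
  rewrite [E ^+ _]exprS mulrA expG_E mulrDl mulmxDr -!mulmxE !mulmxA vE.
  by rewrite !mul0mx add0r mulmxMn mulMnmx !mulmxA.
rewrite IHk; last first.
  by rewrite mulmxBr mulmxBl killedE_H // mulmx_nat mulMnmx vE mul0rn subr0.
rewrite [weight_poly k.+1]big_ord_recr /=.
rewrite [X in _ = _ *: (_ *m horner_mx H X)]mulrC -/(weight_poly k).
rewrite rmorphM /= horner_mxXB natr_mx.
by rewrite -mulmxE mulmxA -[LHS]scaler_nat scalerA [_ * c]mulrC.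
Qed.

Lemma imageE_H (U : 'M[F]_d.+1) :
  (U *m H <= U)%MS -> (U *m E *m H <= U *m E)%MS.
Proof.
move=> UH; have EHm : E *m H = H *m E + E *+ 2 := EH.
rewrite -mulmxA EHm mulmxDr addmx_sub //; first by rewrite mulmxA submxMr.
by rewrite mulmxMn -scaler_nat scalemx_sub.
Qed.

(* Dually, on U / EU the weights of H are nonpositive, so that vectors of positive
   weight lie in EU. *)
Lemma image_weights (U : 'M[F]_d.+1) k :
  (U *m E <= U)%MS -> (U *m G <= U)%MS -> (U *m H <= U)%MS ->
  exists2 c : F, c != 0 & forall v : 'rV_d.+1, (v <= U)%MS ->
  (v *m (E ^+ k * G ^+ k) -
     c *: (v *m horner_mx H (\prod_(i < k) ('X - (- i%:R)%:P))) <= U *m E)%MS.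
Proof.
move=> UE UG UH.
have UXn (X : 'M_d.+1) j : (U *m X <= U)%MS -> (U *m X ^+ j <= U)%MS.
  move=> UX; elim: j => [|j IHj]; first by rewrite mulmx1.
  by rewrite exprSr -mulmxE mulmxA (submx_trans (submxMr _ IHj)).
have UEH := imageE_H UH.
elim: k => [|k [c c0 IHk]].
  exists 1 => [|v vU]; first exact: oner_neq0.
  by rewrite big_ord0 rmorph1 mul1r scale1r subrr sub0mx.
exists (- (c * k.+1%:R)) => [|v vU].
  by rewrite oppr_eq0 mulf_neq0 // natrF_eq0.
(* Modulo U E the term ending in E disappears, and the other one carries the new linear factor H +
   k. *)
rewrite exprSr -mulrA E_expG mulrBr mulmxBr.
have first_term : (v *m (E ^+ k * (G ^+ k.+1 * E)) <= U *m E)%MS.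
  rewrite -!mulmxE !mulmxA; apply: submxMr.
  rewrite (submx_trans (submxMr _ (submxMr _ vU))) //.
  by rewrite (submx_trans (submxMr _ (UXn _ _ UE))) // UXn.
rewrite -addrA addmx_sub // -mulmxE.
rewrite scaleNr opprK big_ord_recr /= [X in horner_mx H X]mulrC rmorphM /= horner_mxXB.
set q := horner_mx H _; have qH : (H - (- k%:R)%:M) * q = q * (H + k%:R).
  rewrite -horner_mxXB -rmorphM mulrC rmorphM /= horner_mxXB.
  by rewrite raddfN opprK natr_mx.
rewrite qH !mulmxMn -[X in - X]scaler_nat addrC mulrC -scalerA -scalerBr.
apply: scalemx_sub; rewrite -!mulmxE !mulmxA scalemxAl -mulmxBl.
rewrite -[X in (X *m _ <= _)%MS]opprB mulNmx eqmx_opp.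
rewrite -[v *m _ *m _]mulmxA mulmxE mulmxDr mulmx_nat addmx_sub //.
  by rewrite (submx_trans (submxMr _ (IHk v vU))).
by rewrite -scaler_nat scalemx_sub // IHk.
Qed.

(** Since X - x divides P - P(x), an eigenvector of H modulo U is one for every polynomial in H. *)
Lemma submx_horner p (U : 'M[F]_d.+1) (v : 'M[F]_(p, d.+1)) (x : F)
  (P : {poly F}) :
  (U *m H <= U)%MS -> (v *m (H - x%:M) <= U)%MS ->
  (v *m horner_mx H P - P.[x] *: v <= U)%MS.
Proof.
move=> UH vHx.
have /factor_theorem[Q defQ] : root (P - P.[x]%:P) x.
  by rewrite /root !hornerE subrr.
have -> : v *m horner_mx H P - P.[x] *: v = v *m horner_mx H (P - P.[x]%:P).
  by rewrite raddfB /= mulmxBr horner_mx_C mul_mx_scalar.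
rewrite defQ mulrC rmorphM raddfB /= horner_mx_X horner_mx_C -mulmxE mulmxA.
apply: (submx_trans (submxMr _ vHx)); exact: horner_mx_stable.
Qed.

Lemma eigen_horner p (v : 'M[F]_(p, d.+1)) (x : F) (P : {poly F}) :
  v *m H = x *: v -> v *m horner_mx H P = P.[x] *: v.
Proof.
move=> vH; apply/eqP; rewrite -subr_eq0 -submx0; apply: submx_horner.
  by rewrite mul0mx sub0mx.
by rewrite mulmxBr vH mul_mx_scalar subrr sub0mx.
Qed.

Variable N : nat.
Hypothesis EN : E ^+ N = 0.

(** As E^N = 0, the product of the H - i for i < N kills v, and no factor vanishes at a negative
    weight. *)
Lemma killedE_eigen_eq0 (v : 'rV_d.+1) k :
  v *m E = 0 -> v *m H = - k.+1%:R *: v -> v = 0.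
Proof.
move=> vE vH; have [c c0 /(_ v vE)] := killedE_weights N.
rewrite EN mulr0 mulmx0 (eigen_horner _ vH) scalerA => /esym/eqP.
rewrite scaler_eq0 mulf_eq0 (negPf c0) /= => /orP[|/eqP//].
rewrite horner_prod prodf_seq_eq0 => /hasP[i _] /=.
by rewrite hornerXsubC -opprD oppr_eq0 -natrD natrF_eq0.
Qed.

(** Two corrections. The vector v E lies in U and has positive weight k + 2 modulo U E, hence lies
    in U E; subtracting an element of U from v gives v1 with v1 E = 0. A polynomial in H then brings
    v1 to exact weight k without changing its class modulo U. *)
Lemma lift_highest_weight (U : 'M[F]_d.+1) (v : 'rV_d.+1) k :
  (U *m E <= U)%MS -> (U *m G <= U)%MS -> (U *m H <= U)%MS ->
  (v *m E <= U)%MS -> (v *m H - k%:R *: v <= U)%MS ->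
  exists w : 'rV_d.+1, [/\ w *m E = 0, w *m H = k%:R *: w & (w - v <= U)%MS].
Proof.
move=> UE UG UH vE vH.
have UEH := imageE_H UH.
have vEUE : (v *m E <= U *m E)%MS.
  have [c c0 /(_ _ vE)] := image_weights N UE UG UH.
  rewrite EN mul0r mulmx0 sub0r eqmx_opp => cq.
  set q := \prod_(i < N) _ in cq.
  have q0 : q.[k.+2%:R] != 0.
    rewrite horner_prod prodf_seq_neq0; apply/allP=> i _ /=.
    by rewrite hornerXsubC opprK -natrD natrF_eq0.
  have vEH : (v *m E *m (H - k.+2%:R%:M) <= U *m E)%MS.
    have EHm : E *m H = H *m E + E *+ 2 := EH.
    have -> : v *m E *m (H - k.+2%:R%:M) = (v *m H - k%:R *: v) *m E.
      rewrite mulmxBr -mulmxA EHm mulmxDr mul_mx_scalar mulmxBl !mulmxA.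
      rewrite mulmxMn -scalemxAl !scaler_nat -addrA; congr (_ + _).
      by rewrite -[k.+2]addn2 mulrnDr opprD addrCA subrr addr0.
    exact: submxMr.
  have vEq := submx_horner q UEH vEH.
  have : (c * q.[k.+2%:R] *: (v *m E) <= U *m E)%MS.
    have -> : (c * q.[k.+2%:R]) *: (v *m E) = c *: (v *m E *m horner_mx H q)
        - c *: (v *m E *m horner_mx H q - q.[k.+2%:R] *: (v *m E)).
      by rewrite scalerBr opprB addrC subrK scalerA.
    by rewrite addmx_sub // eqmx_opp scalemx_sub.
  by rewrite eqmx_scale // mulf_neq0.
have [D defvE] := submxP vEUE.
pose v1 := v - D *m U.
have v1E : v1 *m E = 0 by rewrite mulmxBl defvE mulmxA subrr.
have v1v : (v1 - v <= U)%MS.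
  by rewrite /v1 addrAC subrr sub0r eqmx_opp submxMl.
have v1H : (v1 *m (H - k%:R%:M) <= U)%MS.
  have -> : v1 *m (H - k%:R%:M)
      = (v *m H - k%:R *: v) - (D *m U *m H - k%:R *: (D *m U)).
    rewrite mulmxBr mul_mx_scalar mulmxBl scalerBr !opprB.
    by rewrite addrACA [X in _ + X]addrC addrACA.
  rewrite addmx_sub // eqmx_opp addmx_sub //.
    by rewrite (submx_trans _ UH) // submxMr // submxMl.
  by rewrite eqmx_opp scalemx_sub // submxMl.
(* The degree N + k + 1 is large enough both for X - k to be among the factors of [weight_poly] and
   for E^(N+k+1) = 0 to make that polynomial kill v1. Removing X - k leaves L, and division by L(k)
   makes it a projector. *)
pose L : {poly F} := \prod_(i < (N + k).+1 | (i : nat) != k) ('X - i%:R%:P).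
have defp : weight_poly (N + k).+1 = L * ('X - k%:R%:P).
  have lt_k : (k < (N + k).+1)%N by rewrite ltnS leq_addl.
  by rewrite /weight_poly /L (bigD1 (Ordinal lt_k)) //= mulrC; congr (_ * _).
have L0 : L.[k%:R] != 0.
  rewrite horner_prod; apply/prodf_neq0 => i ik.
  by rewrite hornerXsubC subr_eq0; apply: contraNneq ik => /natrF_inj/esym/eqP.
exists (L.[k%:R]^-1 *: (v1 *m horner_mx H L)); split.
- apply/eqP; rewrite -scalemxAl scaler_eq0 invr_eq0 (negPf L0) /=; apply/eqP.
  elim/poly_ind: L {defp L0} => [|p x IHp]; first by rewrite rmorph0 mulmx0 mul0mx.
  rewrite rmorphD rmorphM /= horner_mx_X horner_mx_C mulmxDr mulmxDl.
  by rewrite -mulmxE mulmxA killedE_H // add0r mul_mx_scalar -scalemxAl v1E scaler0.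
- apply/eqP; rewrite -subr_eq0 -scalemxAl scalerA [k%:R * _]mulrC -scalerA -scalerBr.
  rewrite scaler_eq0 invr_eq0 (negPf L0) /= -mul_mx_scalar -mulmxBr.
  rewrite -horner_mxXB -mulmxA mulmxE -rmorphM -defp.
  have [c c0 /(_ v1 v1E)/esym/eqP] := killedE_weights (N + k).+1.
  rewrite -addnS [E ^+ _]exprD EN mul0r mulr0 mulmx0 scaler_eq0 (negPf c0) /=.
  by rewrite addnS.
- have -> : L.[k%:R]^-1 *: (v1 *m horner_mx H L) - v
      = L.[k%:R]^-1 *: (v1 *m horner_mx H L - L.[k%:R] *: v1) + (v1 - v).
    by rewrite scalerBr scalerA mulVf // scale1r addrA subrK.
  by rewrite addmx_sub // scalemx_sub // submx_horner.
Qed.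

Lemma highest_weight_E (v : 'rV_d.+1) k i : v *m E = 0 -> v *m H = k%:R *: v ->
  v *m G ^+ i.+1 *m E = (i.+1%:R * (k%:R - i%:R)) *: (v *m G ^+ i).
Proof.
move=> vE vH; rewrite -mulmxA mulmxE expG_E mulmxDr -!mulmxE !mulmxA vE mul0mx.
rewrite add0r mulmxMn mulmxA mulmxBr vH mulmx_nat -scaler_nat -scaler_nat.
by rewrite -scalerBl -scalemxAl scalerA.
Qed.

Lemma highest_weight_H (v : 'rV_d.+1) k i : v *m H = k%:R *: v ->
  v *m G ^+ i *m H = (k%:R - (2 * i)%:R) *: (v *m G ^+ i).
Proof.
move=> vH.
have -> : v *m G ^+ i *m H = v *m (H * G ^+ i - G ^+ i *+ (2 * i)).
  by rewrite H_expG mulrDr mulr_natr addrK -mulmxA.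
rewrite mulmxBr -mulmxE mulmxA vH mulmxMn -scaler_nat scalerBl.
by rewrite -scalemxAl.
Qed.

(** E kills v G^(k+1) because the coefficient k - k vanishes, and the weight of this vector is -(k +
    2), which is negative. *)
Lemma highest_weight_expG (v : 'rV_d.+1) k :
  v *m E = 0 -> v *m H = k%:R *: v -> v *m G ^+ k.+1 = 0.
Proof.
move=> vE vH; apply: (killedE_eigen_eq0 (k := k.+1)).
  by rewrite (highest_weight_E _ vE vH) subrr mulr0 scale0r.
rewrite (highest_weight_H _ vH); congr (_ *: _).
have -> : (2 * k.+1 = k + k.+2)%N by lia.
by rewrite natrD opprD addrA subrr sub0r.
Qed.

(** A preimage of u_0 in W is a highest weight vector modulo U. Its exact lift w generates the
    section, with rows w G^i; since w G^(k+1) = 0, the rows out of range agree with the default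
    value 0. *)
Lemma sl2_complement (U W : 'M[F]_d.+1) k (phi : 'M[F]_(d.+1, k.+1)) :
  (U *m E <= U)%MS -> (U *m G <= U)%MS -> (U *m H <= U)%MS ->
  (W *m E <= W)%MS -> (W *m G <= W)%MS -> (W *m H <= W)%MS ->
  (U <= W)%MS -> row_full (W *m phi) ->
  (forall v : 'rV_d.+1, (v <= W)%MS -> (v *m phi == 0) = (v <= U)%MS) ->
  (forall v : 'rV_d.+1, (v <= W)%MS ->
     [/\ v *m E *m phi = v *m phi *m sl2E F k k.+1,
         v *m G *m phi = v *m phi *m sl2F F k.+1 &
         v *m H *m phi = v *m phi *m sl2H F k k.+1]) ->
  exists T : 'M[F]_(k.+1, d.+1),
    [/\ (T <= W)%MS, T *m phi = 1%:M & [/\ T *m E = sl2E F k k.+1 *m T,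
        T *m G = sl2F F k.+1 *m T & T *m H = sl2H F k k.+1 *m T]].
Proof.
move=> UE UG UH WE WG WH UW /row_fullP[B BW] kerphi equi.
have stW (X : 'M[F]_d.+1) (v : 'rV_d.+1) :
    (W *m X <= W)%MS -> (v <= W)%MS -> (v *m X <= W)%MS.
  by move=> WX vW; rewrite (submx_trans (submxMr _ vW)).
pose v : 'rV_d.+1 := rown (B *m W) 0.
have vW : (v <= W)%MS by rewrite /v rown_mul submxMl.
have vphi : v *m phi = rown (1%:M : 'M_k.+1) 0.
  by rewrite /v -rown_mul -mulmxA BW.
have [vE _ vH] := equi v vW.
have [||w [wE wH wv]] := lift_highest_weight (k := k) (v := v) UE UG UH.
- by rewrite -kerphi ?stW // vE vphi -rown_mul mul1mx -[sl2E _ _ _]mulmx1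
    rown_sl2E mul0n scale0r.
- rewrite -kerphi; last by rewrite addmx_sub ?stW // eqmx_opp scalemx_sub.
  rewrite mulmxBl vH -scalemxAl vphi -rown_mul mul1mx -[sl2H _ _ _]mulmx1.
  by rewrite rown_sl2H subr0 subrr.
have wW : (w <= W)%MS.
  by rewrite -[w](subrK v) addmx_sub // (submx_trans wv).
have wphi : w *m phi = rown (1%:M : 'M_k.+1) 0.
  apply/eqP; rewrite -vphi -subr_eq0 -mulmxBl kerphi //.
  exact: submx_trans wv UW.
have wG0 := highest_weight_expG wE wH.
pose T := \matrix_(i < k.+1) (w *m G ^+ i).
have rT i : rown T i = w *m G ^+ i.
  rewrite /rown; case: leqP => [le_ik|lt_ki]; first by rewrite rowK inordK.
  by rewrite -(subnKC lt_ki) exprD -mulmxE mulmxA wG0 mul0mx.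
have wGW i : (w *m G ^+ i <= W)%MS.
  by elim: i => [|i IHi]; rewrite ?mulmx1 // exprSr -mulmxE mulmxA stW.
exists T; split; last split.
- by apply/row_subP => i; rewrite -rown_ord rT.
- apply/row_matrixP => i; rewrite -!rown_ord rown_mul rT.
  elim: {i}(i : nat) => [|i IHi]; first by rewrite mulmx1 wphi.
  rewrite exprSr -mulmxE mulmxA; have [_ -> _] := equi _ (wGW i).
  by rewrite IHi -rown_mul mul1mx -[sl2F _ _]mulmx1 rown_sl2F.
- apply: rownP => i; rewrite rown_sl2E rown_mul !rT.
  case: i => [|i]; first by rewrite mulmx1 wE mul0n scale0r.
  rewrite (highest_weight_E _ wE wH); case: (leqP i k) => [le_ik|lt_ki].
    by rewrite subSS natrM natrB.
  by rewrite -(subnKC lt_ki) exprD -mulmxE mulmxA wG0 mul0mx !scaler0.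
- by apply: rownP => i; rewrite rown_sl2F rown_mul !rT exprSr mulmxA.
- by apply: rownP => i; rewrite rown_sl2H rown_mul !rT (highest_weight_H _ wH).
Qed.

End Sl2Triple.

(** * Morphisms V(m) (x) V(p) -> V(q) *)

Section Equivariant.
Variables (F : fieldType) (charF0 : [pchar F] =i pred0).

(* The maps A i : V(p) -> V(q) give an sl(2)-morphism V(m) (x) V(p) -> V(q), the
   vector v_i acting as A i. *)
Definition equivariant m p q (A : nat -> 'M[F]_(p.+1, q.+1)) : Prop :=
  (forall i, (m < i)%N -> A i = 0) /\
  forall i,
  [/\ A i *m sl2E F q q.+1 =
        sl2E F p p.+1 *m A i + (i * (m.+1 - i))%:R *: A i.-1,
      A i *m sl2F F q.+1 = sl2F F p.+1 *m A i + A i.+1 &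
      A i *m sl2H F q q.+1 =
        sl2H F p p.+1 *m A i + (m%:R - (2 * i)%:R) *: A i].

Section Theory.
Variables (m p q : nat) (A : nat -> 'M[F]_(p.+1, q.+1)).
Hypothesis eqA : equivariant m A.

Lemma equivariant_weight i s t : ent (A i) s t != 0 ->
  (q + 2 * i + 2 * s = p + m + 2 * t)%N.
Proof.
move=> nz; have [_ /(_ i)[_ _ /(congr1 (fun B => ent B s t))]] := eqA.
rewrite entD entZ ent_sl2H_l ent_sl2H_r -mulrDl => /(mulIf nz) e.
apply: (natrF_inj charF0); rewrite !natrD.
have -> : q%:R = (q%:R - (2 * t)%:R) + (2 * t)%:R :> F by rewrite subrK.
by rewrite e; ring.
Qed.

(** As e kills u_0, the relation for E relates row 0 of A i to row 0 of A (i - 1) only. *)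
Lemma equivariant_row i j :
  (j.+1 * (q - j))%:R * ent (A i) 0 j.+1 = (i * (m.+1 - i))%:R * ent (A i.-1) 0 j.
Proof.
have [_ /(_ i)[/(congr1 (fun B => ent B 0 j)) + _ _]] := eqA.
by rewrite entD entZ ent_sl2E_l ent_sl2E_r mul0n mul0r add0r.
Qed.

(** Column 0 of A i F vanishes because u_0 is not in the image of f, so the relation for F becomes a
    recurrence along column 0. *)
Lemma equivariant_col i s : ent (A i) s 0 = (-1) ^+ s * ent (A (i + s)) 0 0.
Proof.
elim: s i => [|s IHs] i; first by rewrite addn0 mul1r.
have [_ /(_ i)[_ /(congr1 (fun B => ent B s 0)) + _]] := eqA.
rewrite entD ent_sl2F_l ent_sl2F_r0 => /esym/eqP; rewrite addr_eq0 => /eqP->.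
by rewrite IHs addSnnS exprS mulN1r mulNr.
Qed.

(** The relation for E determines row 0 from the corner entries, its coefficient being nonzero
    within range; the relation for F then determines every later row. *)
Lemma equivariant_eq0 : (forall i, ent (A i) 0 0 = 0) -> forall i, A i = 0.
Proof.
move=> A00.
have row0 i j : ent (A i) 0 j = 0.
  elim: i j => [|i IHi] [|j] //; have := equivariant_row.
    move/(_ 0%N j); rewrite mul0n mul0r => /eqP.
    rewrite mulf_eq0 natrF_eq0 // muln_eq0 /= => /orP[|/eqP//].
    by rewrite subn_eq0 => le_qj; rewrite ent_out // ltnS le_qj orbT.
  move/(_ i.+1 j); rewrite IHi mulr0 => /eqP.
  rewrite mulf_eq0 natrF_eq0 // muln_eq0 /= => /orP[|/eqP//].
  by rewrite subn_eq0 => le_qj; rewrite ent_out // ltnS le_qj orbT.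
move=> i; apply: entP => s j; rewrite ent0.
elim: s i j => [|s IHs] i j //.
case: (leqP j q) => [le_jq|lt_qj]; last by rewrite ent_out // lt_qj orbT.
have [_ /(_ i)[_ /(congr1 (fun B => ent B s j)) + _]] := eqA.
rewrite entD ent_sl2F_l IHs addr0 => <-.
case: j le_jq => [|j] le_jq; first exact: ent_sl2F_r0.
by rewrite ent_sl2F_rS.
Qed.

(** One half of the Clebsch-Gordan rule: the target must be V(m + p - 2k) with k at most m and p,
    where v_k maps u_0 to a nonzero multiple of u_0. *)
Lemma equivariant_highest i : A i != 0 ->
  exists k, [/\ ent (A k) 0 0 != 0, (k <= m)%N, (k <= p)%N & (q + 2 * k = p + m)%N].
Proof.
move=> Ai; have [|/pred0P none] := pickP (fun k : 'I_m.+1 => ent (A k) 0 0 != 0).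
  move=> k k0; exists k; split => //; first by rewrite -ltnS.
    rewrite leqNgt; apply: contra k0 => lt_pk.
    (* For k > p this entry would reappear, up to sign, in row p + 1, where the default value is
       0. *)
    have := equivariant_col (k - p.+1) p.+1.
    rewrite subnK // ent_out ?ltnSn // => /esym/eqP.
    by rewrite mulf_eq0 signr_eq0.
  by have := equivariant_weight k0; rewrite !muln0 !addn0.
case/eqP: Ai; apply: equivariant_eq0 => k; case: (leqP k m) => [le_km|lt_mk].
  by have := pred0P none (Ordinal (le_km : (k < m.+1)%N)) => /negbFE/eqP.
by have [-> //] := eqA; rewrite ent0.
Qed.

End Theory.

(** Multiplicity one: weights confine the corner entries of both families to the same index k, and
    the combination cancelling that entry is zero. *)
Lemma equivariant_proportional m p q (A B : nat -> 'M[F]_(p.+1, q.+1)) i :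
  equivariant m A -> equivariant m B -> A i != 0 ->
  exists c : F, forall j, B j = c *: A j.
Proof.
move=> eqA eqB Ai; have [k [k0 _ _ wk]] := equivariant_highest eqA Ai.
exists (ent (B k) 0 0 / ent (A k) 0 0) => j; set c := _ / _.
suff /(_ j)/eqP: forall j, B j - c *: A j = 0 by rewrite subr_eq0 => /eqP.
apply: (@equivariant_eq0 m) => [|{}j].
  split=> [{}j lt_mj|{}j].
    by rewrite (proj1 eqA) // (proj1 eqB) // scaler0 subrr.
  have [EA GA HA] := proj2 eqA j; have [EB GB HB] := proj2 eqB j.
  rewrite !mulmxBl !mulmxBr -!scalemxAl -!scalemxAr EA GA HA EB GB HB.
  by split; apply/matrixP => s t; rewrite !mxE; ring.
rewrite -scaleNr entD entZ mulNr; have [<-|jk] := eqVneq k j.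
  by rewrite /c divfK // subrr.
suff z (C : nat -> 'M[F]_(p.+1, q.+1)) : equivariant m C -> ent (C j) 0 0 = 0.
  by rewrite !z // mulr0 subrr.
move=> eqC; apply: contraNeq jk => /(equivariant_weight eqC).
by move=> wj; apply/eqP; lia.
Qed.

Lemma equivariant_scalar p q (Z : 'M[F]_(p.+1, q.+1)) :
  Z *m sl2E F q q.+1 = sl2E F p p.+1 *m Z ->
  Z *m sl2F F q.+1 = sl2F F p.+1 *m Z ->
  Z *m sl2H F q q.+1 = sl2H F p p.+1 *m Z ->
  Z != 0 -> p = q.
Proof.
(* A morphism V(p) -> V(q) is viewed as a morphism from V(0) (x) V(p), for which k <= m = 0. *)
move=> ZE ZG ZH Z0; pose A i := if i == 0%N then Z else 0.
have eqA : equivariant 0 A.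
  split=> [[]//|[|i]]; rewrite /A /=.
    by rewrite ZE ZG ZH !muln0 mul0n subrr !scale0r !addr0.
  by rewrite !mul0mx !mulmx0 subSS sub0n muln0 scale0r scaler0 !addr0.
have [k [_]] := equivariant_highest eqA (Z0 : A 0%N != 0).
by rewrite leqn0 => /eqP-> _; lia.
Qed.

(** * The numerical constraint imposed by the Heisenberg commutator *)

Section Commutator.
Variables (m a b : nat) (al : nat -> 'M[F]_(b.+1, a.+1))
  (be : nat -> 'M[F]_(a.+1, b.+1)) (Z : 'M[F]_a.+1).
Hypotheses (m_odd : odd m) (eq_al : equivariant m al) (eq_be : equivariant m be).
Hypothesis comm : forall i j, be j *m al i - be i *m al j =
  (if (i + j == m)%N then (-1) ^+ i else 0) *: Z.
Variables (i0 j0 : nat) (al0 : al i0 != 0) (be0 : be j0 != 0).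

Lemma diag_weightS k r s : (k + s < m)%N ->
  (diag_weight m k r (k + s.+1) * (s.+1 * (m - k - s + r)) =
   (k + s.+1) * (m - k - s) * diag_weight m k r (k + s))%N.
Proof.
move=> lt_m; rewrite /diag_weight.
have [y defy] : exists y, (m - k - s = y.+1)%N by exists (m - k - s).-1; lia.
have -> : (m - (k + s) + r = (y + r).+1)%N by lia.
have -> : (m - (k + s.+1) + r = y + r)%N by lia.
have e1 : ((k + s).+1 ^_ k * s.+1 = (k + s).+1 * (k + s) ^_ k)%N.
  by rewrite -ffactSS ffactnSr; congr (_ * _)%N; lia.
have e2 : ((y + r).+1 ^_ r * y.+1 = (y + r).+1 * (y + r) ^_ r)%N.
  by rewrite -ffactSS ffactnSr; congr (_ * _)%N; lia.
rewrite defy addnS addSn.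
transitivity (((k + s).+1 ^_ k * s.+1) * ((y + r).+1 * (y + r) ^_ r))%N.
  by rewrite -!mulnA; congr (_ * _)%N; rewrite mulnCA; congr (_ * _)%N; rewrite mulnC.
rewrite e1 -e2; ring.
Qed.

(** The row recurrence for [be] coincides with [diag_weightS], since b - s = m - k - s + r. *)
Lemma equivariant_row_coef k r s : (b + 2 * k = a + m)%N -> (a = k + r)%N ->
  (k + s <= m)%N ->
  ent (be (k + s)) 0 s * (diag_weight m k r k)%:R =
  ent (be k) 0 0 * (diag_weight m k r (k + s))%:R.
Proof.
move=> wk ar; elim: s => [|s IHs] le_m; first by rewrite addn0.
have nz : (s.+1 * (b - s))%:R != 0 :> F.
  by rewrite natrF_eq0 // muln_eq0 negb_or /=; lia.
have row_s := equivariant_row eq_be (k + s.+1) s.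
apply: (mulIf nz); rewrite mulrAC [X in X * _ = _]mulrC row_s addnS /= -mulrA.
rewrite IHs; last by lia.
have -> : (b - s = m - k - s + r)%N by lia.
rewrite -addnS -[RHS]mulrA -natrM diag_weightS; last by lia.
rewrite mulrCA -natrM; congr (_ * (_ * _ * _)%:R); lia.
Qed.

Lemma commutator_coupling : exists k r, [/\ (k <= m)%N, a = (k + r)%N,
  (b + 2 * k = a + m)%N & forall i, (i <= m)%N ->
  (diag_weight m k r i + diag_weight m k r (m - i) =
   diag_weight m k r m + diag_weight m k r 0)%N].
Proof.
have [k [k0 le_km le_ka wk]] := equivariant_highest eq_be be0.
have [l [l0 _ _ wl]] := equivariant_highest eq_al al0.
pose r := (a - k)%N; have ar : a = (k + r)%N by rewrite subnKC.
exists k, r; split=> //.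
pose D i := diag_weight m k r i.
have Dk0 : (D k)%:R != 0 :> F.
  by rewrite natrF_eq0 // /D /diag_weight muln_eq0 negb_or -!lt0n !ffact_gt0; lia.
pose g := ent (be k) 0 0; pose de := ent (al l) 0 0.
(* By weights [al (m - j)] reaches u_0 only from u_(j-k), because l = m - k. For j < k there is no
   such vector, and [D j] is 0 as well. *)
have prod00 j : (j <= m)%N -> ent (be j *m al (m - j)%N) 0 0 * (D k)%:R =
    (-1) ^+ (j + k) * (de * g * (D j)%:R).
  move=> le_jm; rewrite ent_mul.
  under eq_bigr => t _ do rewrite (equivariant_col eq_al).
  have off t : (m - j + t)%N != l -> ent (al (m - j + t)%N) 0 0 = 0.
    apply: contraNeq => /(equivariant_weight eq_al) w; apply/eqP; lia.
  case: (leqP k j) => [le_kj|lt_jk]; last first.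
    rewrite big1 => [|t _]; last by rewrite off ?mulr0 //; lia.
    by rewrite /D /diag_weight (@ffact_small j k) // mul0n !mulr0 mul0r.
  have lt_b : (j - k < b.+1)%N by lia.
  rewrite (bigD1 (Ordinal lt_b)) //= big1 ?addr0 => [|t].
    have -> : (m - j + (j - k) = l)%N by lia.
    have := equivariant_row_coef wk ar (s := (j - k)%N); rewrite subnKC // => /(_ le_jm).
    rewrite -/(D k) -/(D j) -/g -/de => row_j.
    rewrite mulrAC row_j.
    have -> : (-1) ^+ (j + k) = (-1) ^+ (j - k) :> F.
      by rewrite -signr_odd -[RHS]signr_odd oddD oddB.
    by ring.
  rewrite -val_eqE /= => tjk; rewrite off ?mulr0 //; lia.
(* Since m is odd, (-1)^(m-j) = -(-1)^j: the two products in the commutator get opposite signs and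
   their difference becomes a sum. The sign (-1)^j is common to both sides, so the right-hand side
   is independent of j. *)
have sumD j : (j <= m)%N ->
    de * g * (-1) ^+ k * (D j + D (m - j)%N)%:R = - (ent Z 0 0 * (D k)%:R).
  move=> le_jm; have := comm (m - j) j; rewrite subnK // eqxx.
  move/(congr1 (fun B => ent B 0 0 * (D k)%:R)).
  rewrite -scaleN1r entD !entZ mulrDl prod00 // mulN1r mulNr.
  have {1}-> : (be (m - j) *m al j = be (m - j) *m al (m - (m - j)))%N.
    by rewrite subKn.
  rewrite prod00 ?leq_subr //.
  have -> : (-1) ^+ (m - j + k) = - (-1) ^+ (j + k) :> F.
    rewrite -signr_odd -[in RHS]signr_odd !oddD oddB // m_odd /=.
    by case: (odd j); case: (odd k); rewrite /= ?expr0 ?expr1 ?opprK.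
  have -> : (-1) ^+ (m - j) = - (-1) ^+ j :> F.
    rewrite -signr_odd -[in RHS]signr_odd oddB // m_odd /=.
    by case: (odd j); rewrite /= ?expr0 ?expr1 ?opprK.
  rewrite exprD => /(congr1 (fun x => (-1) ^+ j * x)) e.
  have sq : (-1) ^+ j * (-1) ^+ j = 1 :> F by rewrite -expr2 sqrr_sign.
  transitivity ((-1) ^+ j * (-1) ^+ j * (de * g * (-1) ^+ k * (D j + D (m - j)%N)%:R)).
    by rewrite sq mul1r.
  rewrite natrD.
  transitivity ((-1) ^+ j * (-1) ^+ j * - (ent Z 0 0 * (D k)%:R)); last first.
    by rewrite sq mul1r.
  apply: etrans (etrans e _); ring.
move=> i le_im; apply: (natrF_inj charF0).
have nz : de * g * (-1) ^+ k != 0 by rewrite !mulf_neq0 // signr_eq0.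
apply: (mulfI nz); rewrite sumD //; have := sumD m (leqnn m).
by rewrite subnn => ->.
Qed.

End Commutator.
End Equivariant.

(** * Modules over g *)

Section Relations.
Variables (F : fieldType) (n d : nat) (R : grep F n d).
Hypotheses (n_gt0 : (0 < n)%N) (gR : is_gmod R).

(** The sum has at most one term; it extends [rX] by 0 to all natural indices, as [equivariant]
    expects. *)
Definition repX (i : nat) : 'M[F]_d := \sum_(j < n.*2 | j == i :> nat) rX R j.

Lemma repX_ord (i : 'I_n.*2) : repX i = rX R i.
Proof. by rewrite /repX (big_pred1 i). Qed.

Lemma repX_out i : (mH n < i)%N -> repX i = 0.
Proof.
rewrite /mH => lt_i; rewrite /repX big_pred0 // => j.
by apply/eqP => ji; have := ltn_ord j; rewrite ji; lia.
Qed.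

Lemma rho_br (x y : gelt F n) :
  rho R (gbr x y) = rho R y *m rho R x - rho R x *m rho R y.
Proof.
by apply/row_matrixP => i; rewrite !rowE gR mulmxBr !mulmxA.
Qed.

Lemma rho_sl2 e f h : rho R (GElt e f h 0 0) = e *: rE R + f *: rF R + h *: rH R.
Proof.
rewrite /rho /= scale0r addr0 big1 ?addr0 // => i _.
by rewrite mxE scale0r.
Qed.

Lemma rho_vec (w : 'rV_(n.*2)) :
  rho R (GElt 0 0 0 w 0) = \sum_i w 0 i *: rX R i.
Proof. by rewrite /rho /= !scale0r !add0r addr0. Qed.

Lemma rho_delta (i : 'I_n.*2) : rho R (GElt 0 0 0 (delta_mx 0 i) 0) = repX i.
Proof.
rewrite rho_vec repX_ord (bigD1 i) //= mxE !eqxx scale1r big1 ?addr0 // => j.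
by move=> /negPf ji; rewrite mxE ji andbF scale0r.
Qed.

Lemma rho_center z : rho R (GElt 0 0 0 0 z) = z *: rZ R.
Proof.
rewrite /rho /= !scale0r !add0r big1 ?add0r // => i _.
by rewrite mxE scale0r.
Qed.

Lemma gbr_sl2_vec e f h (w : 'rV[F]_(n.*2)) :
  gbr (GElt e f h 0 0) (GElt 0 0 0 w 0) =
  GElt 0 0 0 (w *m sl2act (GElt e f h 0 0)) 0.
Proof.
rewrite /gbr /= !mulr0 !subrr !mulr0 mul0mx subr0; congr GElt.
rewrite /omega big1 // => i _; rewrite big1 // => j _.
by case: ifP => // _; rewrite mxE mulr0 mul0r.
Qed.

Lemma relFE : rF R *m rE R - rE R *m rF R = rH R.
Proof.
have := rho_br (GElt 1 0 0 0 0) (GElt 0 1 0 0 0).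
rewrite !rho_sl2 !scale0r !scale1r !add0r !addr0 => <-.
rewrite /gbr /= !mul0mx subrr /omega big1 => [|i _]; last first.
  by rewrite big1 // => j _; rewrite mxE mulr0 mul0r if_same.
by rewrite rho_sl2 !(mul0r, mulr0, mulr1, subr0) !scale0r scale1r !add0r.
Qed.

Lemma relEH : rE R *m rH R = rH R *m rE R + rE R *+ 2.
Proof.
have := rho_br (GElt 0 0 1 0 0) (GElt 1 0 0 0 0).
rewrite !rho_sl2 !scale0r !scale1r !add0r !addr0 => /eqP; rewrite eq_sym subr_eq => /eqP->.
rewrite addrC; congr (_ + _).
rewrite /gbr /= !mul0mx subrr /omega big1 => [|i _]; last first.
  by rewrite big1 // => j _; rewrite mxE mulr0 mul0r if_same.
by rewrite rho_sl2 !(mul0r, mulr0, mulr1, subr0) !scale0r !addr0 scaler_nat.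
Qed.

Lemma relFH : rF R *m rH R = rH R *m rF R - rF R *+ 2.
Proof.
have := rho_br (GElt 0 0 1 0 0) (GElt 0 1 0 0 0).
rewrite !rho_sl2 !scale0r !scale1r !add0r !addr0 => /eqP; rewrite eq_sym subr_eq => /eqP->.
rewrite addrC; congr (_ + _).
rewrite /gbr /= !mul0mx subrr /omega big1 => [|i _]; last first.
  by rewrite big1 // => j _; rewrite mxE mulr0 mul0r if_same.
rewrite rho_sl2 !(mul0r, mulr0, mulr1, subr0, sub0r, mulrN, oppr0) !scale0r !addr0 add0r.
by rewrite scaleNr scaler_nat.
Qed.

Lemma relXs e f h (i : 'I_n.*2) :
  repX i *m (e *: rE R + f *: rF R + h *: rH R) =
  (e *: rE R + f *: rF R + h *: rH R) *m repX i +
  \sum_j sl2act (GElt e f h 0 0 : gelt F n) i j *: rX R j.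
Proof.
have := rho_br (GElt e f h 0 0) (GElt 0 0 0 (delta_mx 0 i) 0).
rewrite gbr_sl2_vec rho_vec rho_delta rho_sl2 => /eqP.
rewrite eq_sym subr_eq => /eqP->; rewrite addrC; congr (_ + _).
by apply: eq_bigr => j _; rewrite -rowE mxE.
Qed.

Lemma sum_rX (s : 'I_n.*2 -> F) (t : nat) (x : F) :
  (forall j : 'I_n.*2, s j = if j == t :> nat then x else 0) ->
  \sum_j s j *: rX R j = x *: repX t.
Proof.
move=> sE; rewrite /repX scaler_sumr [RHS]big_mkcond; apply: eq_bigr => j _.
by rewrite sE; case: ifP => _; rewrite ?scale0r.
Qed.

Lemma ord_or_out (P : nat -> Prop) : (forall i : 'I_n.*2, P i) ->
  (forall i, (mH n < i)%N -> P i) -> forall i, P i.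
Proof.
move=> Pord Pout i; case: (ltnP (mH n) i) => [/Pout//|le_i].
have lt_i : (i < n.*2)%N by move: le_i; rewrite /mH; lia.
exact: (Pord (Ordinal lt_i)).
Qed.

Lemma relXE i : repX i *m rE R =
  rE R *m repX i + (i * ((mH n).+1 - i))%:R *: repX i.-1.
Proof.
move: i; apply: ord_or_out => [i|i lt_i]; last first.
  have -> : ((mH n).+1 - i = 0)%N by lia.
  by rewrite repX_out // mul0mx mulmx0 muln0 scale0r addr0.
have := relXs 1 0 0 i; rewrite !scale0r scale1r !addr0 => ->; congr (_ + _).
apply: sum_rX => j; rewrite /sl2act /= !scale0r scale1r !addr0 mxE.
have lt_i := ltn_ord i.
have -> : (mH n - i).+1 = ((mH n).+1 - i)%N by rewrite subSn // /mH; lia.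
case: (posnP i) => [i0|i_gt0]; first by rewrite i0 mul0n /= if_same.
by have -> : (j.+1 == i) = (j == i.-1 :> nat) by lia.
Qed.

Lemma relXF i : repX i *m rF R = rF R *m repX i + repX i.+1.
Proof.
move: i; apply: ord_or_out => [i|i lt_i]; last first.
  by rewrite !repX_out ?mul0mx ?mulmx0 ?addr0 // ltnW.
have := relXs 0 1 0 i; rewrite !scale0r scale1r !addr0 add0r => ->.
congr (_ + _); rewrite -[repX i.+1]scale1r.
by apply: sum_rX => j; rewrite /sl2act /= !scale0r scale1r addr0 add0r mxE.
Qed.

Lemma relXH i : repX i *m rH R =
  rH R *m repX i + ((mH n)%:R - (2 * i)%:R) *: repX i.
Proof.
move: i; apply: ord_or_out => [i|i lt_i]; last first.
  by rewrite repX_out // mul0mx mulmx0 scaler0 addr0.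
have := relXs 0 0 1 i; rewrite !scale0r scale1r !add0r => ->.
congr (_ + _); apply: sum_rX => j; rewrite /sl2act /= !scale0r scale1r !add0r.
by rewrite mxE eq_sym.
Qed.

Lemma omega_delta (i j : 'I_n.*2) : omega (delta_mx 0 i) (delta_mx 0 j) =
  if (i + j == mH n)%N then (-1) ^+ i else 0 :> F.
Proof.
rewrite /omega (bigD1 i) //= [X in _ + X]big1 ?addr0 => [|k /negPf ki].
  rewrite (bigD1 j) //= [X in _ + X]big1 ?addr0 => [|k /negPf kj].
    by rewrite !mxE !eqxx !mulr1.
  by rewrite !mxE kj andbF mulr0 if_same.
by rewrite big1 // => k' _; rewrite !mxE ki andbF mulr0 mul0r if_same.
Qed.

Lemma relXX i j : repX j *m repX i - repX i *m repX j =
  (if (i + j == mH n)%N then (-1) ^+ i else 0) *: rZ R.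
Proof.
move: i; apply: ord_or_out => [i|i lt_i]; last first.
  by rewrite (repX_out lt_i) mul0mx mulmx0 subr0 ifN ?scale0r // neq_ltn; lia.
move: j; apply: ord_or_out => [j|j lt_j]; last first.
  by rewrite (repX_out lt_j) mul0mx mulmx0 subr0 ifN ?scale0r // neq_ltn; lia.
have := rho_br (GElt 0 0 0 (delta_mx 0 i) 0) (GElt 0 0 0 (delta_mx 0 j) 0).
rewrite !rho_delta => <-; rewrite /gbr /= !mulr0 !subrr !mulr0.
rewrite /sl2act /= !scale0r !addr0 !mulmx0 subrr omega_delta.
by rewrite rho_center.
Qed.

Lemma relZs e f h : rZ R *m (e *: rE R + f *: rF R + h *: rH R) =
  (e *: rE R + f *: rF R + h *: rH R) *m rZ R.
Proof.
have := rho_br (GElt e f h 0 0) (GElt 0 0 0 0 1).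
rewrite rho_sl2 rho_center scale1r => /eqP; rewrite eq_sym subr_eq => /eqP->.
rewrite -[RHS]add0r; congr (_ + _).
have -> : gbr (GElt e f h 0 0) (GElt 0 0 0 0 1) = GElt 0 0 0 0 (0 : F) :> gelt F n.
  rewrite /gbr /= !mulr0 !subrr !mulr0 !mul0mx subrr /omega; congr GElt.
  by rewrite big1 // => i _; rewrite big1 // => j _; rewrite mxE mulr0 mul0r if_same.
by rewrite rho_center scale0r.
Qed.

Lemma rhoE (x : gelt F n) : rho R x = ge x *: rE R + gf x *: rF R + gh x *: rH R
  + \sum_(i < n.*2) gv x 0 i *: repX i + gz x *: rZ R.
Proof.
rewrite /rho; congr (_ + _ + _); apply: eq_bigr => i _; by rewrite repX_ord.
Qed.

End Relations.

(** * Splitting a uniserial module of length 3 over sl(2) *)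

Definition sl2_intertwines (F : fieldType) n d (R : grep F n d) k
    (T : 'M[F]_(k.+1, d)) : Prop :=
  [/\ T *m rE R = sl2E F k k.+1 *m T, T *m rF R = sl2F F k.+1 *m T &
      T *m rH R = sl2H F k k.+1 *m T].

(* The rows of Ta, Tb, Tc are bases of sl(2)-submodules V(a), V(b), V(c) with direct
   sum F^d, and Pa, Pb, Pc are the coordinate maps. *)
Record splitting (F : fieldType) n d (R : grep F n d) (a b c : nat) := Splitting {
  Ta : 'M[F]_(a.+1, d); Tb : 'M[F]_(b.+1, d); Tc : 'M[F]_(c.+1, d);
  Pa : 'M[F]_(d, a.+1); Pb : 'M[F]_(d, b.+1); Pc : 'M[F]_(d, c.+1);
  sum_PT : Pa *m Ta + Pb *m Tb + Pc *m Tc = 1%:M;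
  TaP : [/\ Ta *m Pa = 1%:M, Ta *m Pb = 0 & Ta *m Pc = 0];
  TbP : [/\ Tb *m Pa = 0, Tb *m Pb = 1%:M & Tb *m Pc = 0];
  TcP : [/\ Tc *m Pa = 0, Tc *m Pb = 0 & Tc *m Pc = 1%:M];
  Ta_sl2 : sl2_intertwines R Ta;
  Tb_sl2 : sl2_intertwines R Tb;
  Tc_sl2 : sl2_intertwines R Tc;
  TaX : forall i, Ta *m repX R i = 0;
  TbX : forall i, Tb *m repX R i = Tb *m repX R i *m Pa *m Ta;
  TcX : forall i, Tc *m repX R i =
    Tc *m repX R i *m Pa *m Ta + Tc *m repX R i *m Pb *m Tb }.

Section Existence.
Variables (F : fieldType) (charF0 : [pchar F] =i pred0).
Variables (n d : nat) (R : grep F n d.+1).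
Hypotheses (n_gt0 : (0 < n)%N) (gR : is_gmod R).

Lemma submod_gens (U : 'M[F]_d.+1) : submod R U ->
  [/\ (U *m rE R <= U)%MS, (U *m rF R <= U)%MS, (U *m rH R <= U)%MS &
      forall i, (U *m repX R i <= U)%MS].
Proof.
move=> sU; have s e f h : (U *m (e *: rE R + f *: rF R + h *: rH R) <= U)%MS.
  by rewrite -rho_sl2.
split.
- by have := s 1 0 0; rewrite !scale0r scale1r !addr0.
- by have := s 0 1 0; rewrite !scale0r scale1r !addr0 add0r.
- by have := s 0 0 1; rewrite !scale0r scale1r !add0r.
apply: (ord_or_out n_gt0) => [i|i lt_i]; first by rewrite -rho_delta.
by rewrite repX_out // mulmx0 sub0mx.
Qed.

Lemma soc_over_submod (U S : 'M[F]_d.+1) :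
  submod R U -> is_soc_over R U S -> submod R S /\ (U <= S)%MS.
Proof.
move=> sU [_ [k [Ws [simW /eqmxP defS]]]]; split; last by rewrite defS addsmxSl.
move=> x; rewrite (eqmxMr _ defS) defS addsmxMr addsmx_sub.
rewrite (submx_trans (sU x)) ?addsmxSl //= sumsmxMr.
apply/sumsmx_subP => i _; have [sW _ _] := simW i.
by rewrite (submx_trans (sW x)) // (submx_trans _ (addsmxSr _ _)) // (sumsmx_sup i).
Qed.

(** The content of [factor_iso] on generators, for matrices of any height, so that it applies
    directly to the sections T. *)
Definition sl2_factor (U W : 'M[F]_d.+1) k (phi : 'M[F]_(d.+1, k.+1)) : Prop :=
  [/\ row_full (W *m phi),
      forall p (A : 'M[F]_(p, d.+1)), (A <= W)%MS -> (A *m phi == 0) = (A <= U)%MS &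
      forall p (A : 'M[F]_(p, d.+1)), (A <= W)%MS ->
       [/\ A *m rE R *m phi = A *m phi *m sl2E F k k.+1,
           A *m rF R *m phi = A *m phi *m sl2F F k.+1,
           A *m rH R *m phi = A *m phi *m sl2H F k k.+1 &
           forall i, A *m repX R i *m phi = 0]].

Lemma factor_isoP (U W : 'M[F]_d.+1) k : factor_iso R U W k ->
  exists phi : 'M[F]_(d.+1, k.+1), sl2_factor U W phi.
Proof.
case=> phi [full ker equi]; exists phi; split=> // p A AW.
  apply/eqP/row_subP => [A0 i|AU].
    by rewrite -ker ?(submx_trans (row_sub _ _)) // -row_mul A0 row0.
  by apply/row_matrixP => i; rewrite row_mul row0; apply/eqP; rewrite ker //
    (submx_trans (row_sub _ _)).
have equiA x : A *m rho R x *m phi = A *m phi *m vrep k x.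
  apply/row_matrixP => i; rewrite !row_mul equi //.
  exact: submx_trans (row_sub _ _) AW.
have s e f h := equiA (GElt e f h 0 0).
split.
- by have := s 1 0 0; rewrite rho_sl2 /vrep /= !scale0r !scale1r !addr0.
- by have := s 0 1 0; rewrite rho_sl2 /vrep /= !scale0r !scale1r !addr0 !add0r.
- by have := s 0 0 1; rewrite rho_sl2 /vrep /= !scale0r !scale1r !add0r.
apply: (ord_or_out n_gt0) => [i|i lt_i]; last by rewrite repX_out // mulmx0 mul0mx.
by rewrite -rho_delta equiA /vrep /= !scale0r !addr0 mulmx0.
Qed.

(** The nilpotency of E on V(k) carries W into U; chained over the factors, this makes [rE R]
    nilpotent, as the lifting of highest weight vectors requires. *)
Lemma factor_nilpotent (U W : 'M[F]_d.+1) k phi p (A : 'M[F]_(p, d.+1)) :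
  sl2_factor U W (k := k) phi -> (W *m rE R <= W)%MS -> (A <= W)%MS ->
  (A *m (rE R) ^+ k.+1 <= U)%MS.
Proof.
move=> [_ ker equi] WE AW.
have AWj j : (A *m (rE R) ^+ j <= W)%MS.
  elim: j => [|j IHj]; first by rewrite mulmx1.
  by rewrite exprSr -mulmxE mulmxA (submx_trans (submxMr _ IHj)).
have AEj j : A *m (rE R) ^+ j *m phi = A *m phi *m (sl2E F k k.+1) ^+ j.
  elim: j => [|j IHj]; first by rewrite !mulmx1.
  rewrite !exprSr -!mulmxE !mulmxA; have [-> _ _ _] := equi _ _ (AWj j).
  by rewrite IHj.
by rewrite -ker // AEj sl2E_expn mulmx0.
Qed.

Lemma factor_complement (U W : 'M[F]_d.+1) k phi N :
  submod R U -> submod R W -> (U <= W)%MS -> sl2_factor U W (k := k) phi ->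
  (rE R) ^+ N = 0 ->
  exists T : 'M[F]_(k.+1, d.+1),
    [/\ (T <= W)%MS, T *m phi = 1%:M & sl2_intertwines R T].
Proof.
move=> sU sW UW [full ker equi] EN.
have [UE UG UH _] := submod_gens sU; have [WE WG WH _] := submod_gens sW.
have split_gens := sl2_complement charF0 (relFE gR) (relEH gR) (relFH gR) EN
  UE UG UH WE WG WH UW full.
apply: split_gens => v vW; first exact: ker.
by have [? ? ? _] := equi _ _ vW.
Qed.

Lemma uniserial3_splitting a b c : uniserial3 R a b c ->
  inhabited (splitting R a b c).
Proof.
case=> S1 [S2 [[soc1 soc2 _] [/factor_isoP[f1 fac1] /factor_isoP[f2 fac2]
  /factor_isoP[f3 fac3]]]].
have s0 : submod R (0 : 'M_d.+1) by move=> x; rewrite mul0mx sub0mx.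
have [s1 _] := soc_over_submod s0 soc1.
have [s2 le12] := soc_over_submod s1 soc2.
have s3 : submod R (1%:M : 'M_d.+1) by move=> x; rewrite submx1.
have [E1 _ _ X1] := submod_gens s1; have [E2 _ _ X2] := submod_gens s2.
(* Each block of factors moves one step down the chain V, S2, S1, 0. *)
have EN : (rE R) ^+ (c.+1 + b.+1 + a.+1) = 0.
  apply/eqP; rewrite -submx0 -[_ ^+ _]mul1mx !exprD -!mulmxE !mulmxA.
  apply: (factor_nilpotent fac1 E1); apply: (factor_nilpotent fac2 E2).
  by apply: (factor_nilpotent fac3) => //; apply: submx1.
have [T1 [T1S T1f T1s]] := factor_complement s0 s1 (sub0mx _ _) fac1 EN.
have [T2 [T2S T2f T2s]] := factor_complement s1 s2 le12 fac2 EN.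
have [T3 [T3S T3f T3s]] := factor_complement s2 s3 (submx1 _) fac3 EN.
have [_ k1 e1] := fac1; have [_ k2 e2] := fac2; have [_ k3 e3] := fac3.
have T1f2 : T1 *m f2 = 0.
  by apply/eqP; rewrite k2 // (submx_trans T1S).
have T1f3 : T1 *m f3 = 0.
  by apply/eqP; rewrite k3 ?submx1 // (submx_trans T1S).
have T2f3 : T2 *m f3 = 0 by apply/eqP; rewrite k3 ?submx1.
(* The maps f2 and f1 are controlled on S2 and S1 only, so the components already found are
   subtracted before they are applied. *)
have [pb pbE] : exists pb, pb = (1%:M - f3 *m T3) *m f2.
  by exists ((1%:M - f3 *m T3) *m f2).
have [pa paE] : exists pa, pa = (1%:M - f3 *m T3 - pb *m T2) *m f1.
  by exists ((1%:M - f3 *m T3 - pb *m T2) *m f1).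
have in1 p (A : 'M_(p, d.+1)) : (A <= S1)%MS -> A = A *m f1 *m T1.
  move=> AS; apply/eqP; rewrite -subr_eq0 -submx0 -k1.
    by rewrite mulmxBl -(mulmxA (A *m f1)) T1f mulmx1 subrr.
  by rewrite addmx_sub // eqmx_opp (submx_trans (submxMl _ _)).
have in2 p (A : 'M_(p, d.+1)) : (A <= S2)%MS -> (A - A *m f2 *m T2 <= S1)%MS.
  move=> AS; rewrite -k2; last first.
    by rewrite addmx_sub // eqmx_opp (submx_trans (submxMl _ _)).
  by rewrite mulmxBl -(mulmxA (A *m f2)) T2f mulmx1 subrr.
have in3 : (1%:M - f3 *m T3 <= S2)%MS.
  by rewrite -k3 ?submx1 // mulmxBl mul1mx -mulmxA T3f mulmx1 subrr.
have kill p (A : 'M_(p, d.+1)) : (A <= S2)%MS -> A *m f3 = 0.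
  by move=> AS; apply/eqP; rewrite k3 ?submx1.
have kill2 p (A : 'M_(p, d.+1)) : (A <= S1)%MS -> A *m f2 = 0.
  by move=> AS; apply/eqP; rewrite k2 ?(submx_trans AS).
have pbS2 p (A : 'M_(p, d.+1)) : (A <= S2)%MS -> A *m pb = A *m f2.
  by move=> AS; rewrite pbE mulmxA mulmxBr mulmx1 mulmxA kill // mul0mx subr0.
have paS1 p (A : 'M_(p, d.+1)) : (A <= S1)%MS -> A *m pa = A *m f1.
  move=> AS; have AS2 := submx_trans AS le12.
  rewrite paE mulmxA !mulmxBr mulmx1 !mulmxA kill // mul0mx subr0.
  by rewrite pbS2 // kill2 // mul0mx subr0.
have paS2 p (A : 'M_(p, d.+1)) : (A <= S2)%MS -> A *m pa = (A - A *m f2 *m T2) *m f1.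
  move=> AS; rewrite paE mulmxA !mulmxBr mulmx1 !mulmxA kill // mul0mx subr0.
  by rewrite pbS2.
have T3pb : T3 *m pb = 0.
  by rewrite pbE mulmxA mulmxBr mulmx1 mulmxA T3f mul1mx subrr mul0mx.
split; exists T1 T2 T3 pa pb f3.
- have -> : pa *m T1 = 1%:M - f3 *m T3 - pb *m T2.
    by rewrite paE -in1 // pbE in2.
  by rewrite subrK subrK.
- by rewrite paS1 // T1f pbS2 ?(submx_trans T1S).
- by rewrite paS2 // T2f pbS2 // T2f mul1mx subrr mul0mx.
- split=> //; rewrite paE mulmxA !mulmxBr mulmx1 !mulmxA T3f mul1mx subrr.
  by rewrite T3pb mul0mx subr0 mul0mx.
- by [].
- by [].
- by [].
- move=> i; have [_ _ _ /(_ i)/eqP] := e1 _ _ T1S; rewrite k1 ?submx0.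
    by move/eqP.
  by rewrite (submx_trans (submxMr _ T1S)).
- move=> i; have TX : (T2 *m repX R i <= S1)%MS.
    have [_ _ _ /(_ i)/eqP] := e2 _ _ T2S; rewrite k2 //.
    by rewrite (submx_trans (submxMr _ T2S)).
  by rewrite paS1 // -in1.
- move=> i; have TX : (T3 *m repX R i <= S2)%MS.
    have [_ _ _ /(_ i)/eqP] := e3 _ _ T3S; rewrite k3 // ?submx1 //.
  by rewrite paS2 // pbS2 // -in1 ?in2 // subrK.
Qed.

End Existence.

(** * Blocks of the Heisenberg action in a splitting *)

Section Blocks.
Variables (F : fieldType) (charF0 : [pchar F] =i pred0).
Variables (n d : nat) (R : grep F n d) (a b c : nat) (S : splitting R a b c).
Hypotheses (n_gt0 : (0 < n)%N) (gR : is_gmod R).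

(** The letters give source and target: [blockba] is the family al, [blockcb] the family be, and
    [blockca] the third one. *)
Definition blockba i := Tb S *m repX R i *m Pa S.
Definition blockcb i := Tc S *m repX R i *m Pb S.
Definition blockca i := Tc S *m repX R i *m Pa S.
Definition blockZ := Tc S *m rZ R *m Pa S.

Lemma splitting_ext p (A B : 'M_(d, p)) : Ta S *m A = Ta S *m B ->
  Tb S *m A = Tb S *m B -> Tc S *m A = Tc S *m B -> A = B.
Proof.
move=> eqa eqb eqc; rewrite -[A]mul1mx -[B]mul1mx -(sum_PT S) !mulmxDl.
by rewrite -!mulmxA eqa eqb eqc.
Qed.

Lemma TcXX i j : Tc S *m repX R j *m repX R i = blockcb j *m blockba i *m Ta S.
Proof.
rewrite (TcX S) mulmxDl -[_ *m Ta S *m _]mulmxA (TaX S) mulmx0 add0r.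
by rewrite -[_ *m Tb S *m _]mulmxA (TbX S) !mulmxA.
Qed.

(** As omega(v_0, v_m) = 1, the center acts as a commutator of two operators that go strictly down
    the filtration; it therefore kills V(a) and V(b) and sends V(c) into V(a). *)
Lemma rZ_comm : rZ R = repX R (mH n) *m repX R 0 - repX R 0 *m repX R (mH n).
Proof. by rewrite (relXX n_gt0 gR) add0n eqxx scale1r. Qed.

Lemma TaZ : Ta S *m rZ R = 0.
Proof. by rewrite rZ_comm mulmxBr !mulmxA !(TaX S) !mul0mx subrr. Qed.

Lemma TbZ : Tb S *m rZ R = 0.
Proof.
rewrite rZ_comm mulmxBr !mulmxA (TbX S) [Tb S *m repX R 0](TbX S).
by rewrite -!(mulmxA _ (Ta S)) !(TaX S) !mulmx0 subrr.
Qed.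

Lemma block_comm i j : blockcb j *m blockba i - blockcb i *m blockba j =
  (if (i + j == mH n)%N then (-1) ^+ i else 0) *: blockZ.
Proof.
have [Taa _ _] := TaP S.
rewrite -[LHS]mulmx1 -Taa mulmxA mulmxBl -!TcXX -!(mulmxA (Tc S)) -mulmxBr.
by rewrite (relXX n_gt0 gR) -scalemxAr -scalemxAl.
Qed.

Lemma TcZ : Tc S *m rZ R = blockZ *m Ta S.
Proof.
have := block_comm 0 (mH n); rewrite add0n eqxx scale1r => <-.
by rewrite mulmxBl -!TcXX rZ_comm mulmxBr !mulmxA.
Qed.

Lemma blockba_equivariant : equivariant (mH n) blockba.
Proof.
have [bE bG bH] := Tb_sl2 S; have [aE aG aH] := Ta_sl2 S; have [Taa _ _] := TaP S.
split=> [i lt_i|i]; first by rewrite /blockba repX_out // mulmx0 mul0mx.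
(* The rows of [Tb S *m repX R i] lie in the span of [Ta S], where X acts as Y, so Y after the block
   equals X before the projection. *)
have push X Y : Ta S *m X = Y *m Ta S ->
    blockba i *m Y = Tb S *m (repX R i *m X) *m Pa S.
  by move=> aX; rewrite mulmxA (TbX S) -(mulmxA _ (Ta S)) aX -!mulmxA Taa mulmx1.
split; rewrite (push _ _ aE, push _ _ aG, push _ _ aH).
- rewrite (relXE n_gt0 gR) mulmxDr mulmxDl mulmxA bE -scalemxAr -scalemxAl.
  by rewrite /blockba !mulmxA.
- by rewrite (relXF n_gt0 gR) mulmxDr mulmxDl mulmxA bG /blockba !mulmxA.
rewrite (relXH n_gt0 gR) mulmxDr mulmxDl mulmxA bH -scalemxAr -scalemxAl.
by rewrite /blockba !mulmxA.
Qed.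

Lemma blockcb_equivariant : equivariant (mH n) blockcb.
Proof.
have [bE bG bH] := Tb_sl2 S; have [aE aG aH] := Ta_sl2 S; have [cE cG cH] := Tc_sl2 S.
have [_ Tab _] := TaP S; have [_ Tbb _] := TbP S.
split=> [i lt_i|i]; first by rewrite /blockcb repX_out // mulmx0 mul0mx.
have push X Y Y' : Ta S *m X = Y' *m Ta S -> Tb S *m X = Y *m Tb S ->
    blockcb i *m Y = Tc S *m (repX R i *m X) *m Pb S.
  move=> aX bX; rewrite mulmxA (TcX S) mulmxDl -(mulmxA _ (Ta S)) aX.
  rewrite -(mulmxA _ (Tb S)) bX mulmxDl -!mulmxA Tab Tbb !mulmx0 mulmx1 add0r.
  by rewrite /blockcb !mulmxA.
split; rewrite (push _ _ _ aE bE, push _ _ _ aG bG, push _ _ _ aH bH).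
- rewrite (relXE n_gt0 gR) mulmxDr mulmxDl mulmxA cE -scalemxAr -scalemxAl.
  by rewrite /blockcb !mulmxA.
- by rewrite (relXF n_gt0 gR) mulmxDr mulmxDl mulmxA cG /blockcb !mulmxA.
rewrite (relXH n_gt0 gR) mulmxDr mulmxDl mulmxA cH -scalemxAr -scalemxAl.
by rewrite /blockcb !mulmxA.
Qed.

Lemma blockca_equivariant : equivariant (mH n) blockca.
Proof.
have [bE bG bH] := Tb_sl2 S; have [aE aG aH] := Ta_sl2 S; have [cE cG cH] := Tc_sl2 S.
have [Taa _ _] := TaP S; have [Tba _ _] := TbP S.
split=> [i lt_i|i]; first by rewrite /blockca repX_out // mulmx0 mul0mx.
have push X Y Y' : Ta S *m X = Y *m Ta S -> Tb S *m X = Y' *m Tb S ->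
    blockca i *m Y = Tc S *m (repX R i *m X) *m Pa S.
  move=> aX bX; rewrite mulmxA (TcX S) mulmxDl -(mulmxA _ (Ta S)) aX.
  rewrite -(mulmxA _ (Tb S)) bX mulmxDl -!mulmxA Taa Tba !mulmx0 mulmx1 addr0.
  by rewrite /blockca !mulmxA.
split; rewrite (push _ _ _ aE bE, push _ _ _ aG bG, push _ _ _ aH bH).
- rewrite (relXE n_gt0 gR) mulmxDr mulmxDl mulmxA cE -scalemxAr -scalemxAl.
  by rewrite /blockca !mulmxA.
- by rewrite (relXF n_gt0 gR) mulmxDr mulmxDl mulmxA cG /blockca !mulmxA.
rewrite (relXH n_gt0 gR) mulmxDr mulmxDl mulmxA cH -scalemxAr -scalemxAl.
by rewrite /blockca !mulmxA.
Qed.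

Lemma blockZ_neq0 : faithful R -> blockZ != 0.
Proof.
move=> inj; apply/eqP => Z0.
have rZ0 : rZ R = 0.
  by apply: splitting_ext; rewrite mulmx0 ?TaZ ?TbZ // TcZ Z0 mul0mx.
have : GElt 0 0 0 0 (1 : F) = GElt 0 0 0 0 0 :> gelt F n.
  by apply: inj; rewrite !rho_center rZ0 !scaler0.
by case=> /eqP; rewrite oner_eq0.
Qed.

Lemma mH_odd : odd (mH n).
Proof. by rewrite /mH; case: n n_gt0 => // k _; rewrite doubleS /= odd_double. Qed.

Lemma blockZ_ends : blockZ != 0 -> c = a.
Proof.
have [aE aG aH] := Ta_sl2 S; have [cE cG cH] := Tc_sl2 S; have [Taa _ _] := TaP S.
have push X Y Y' : Ta S *m X = Y *m Ta S -> Tc S *m X = Y' *m Tc S ->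
    rZ R *m X = X *m rZ R -> blockZ *m Y = Y' *m blockZ.
  move=> aX cX ZX; rewrite -[blockZ *m Y]mulmx1 -Taa mulmxA -(mulmxA blockZ).
  by rewrite -aX mulmxA -TcZ -(mulmxA (Tc S)) ZX mulmxA cX /blockZ !mulmxA.
have ZE : rZ R *m rE R = rE R *m rZ R.
  by have := relZs gR 1 0 0; rewrite !scale0r scale1r !addr0.
have ZG : rZ R *m rF R = rF R *m rZ R.
  by have := relZs gR 0 1 0; rewrite !scale0r scale1r !addr0 add0r.
have ZH : rZ R *m rH R = rH R *m rZ R.
  by have := relZs gR 0 0 1; rewrite !scale0r scale1r !add0r.
exact: (equivariant_scalar charF0 (push _ _ _ aE cE ZE) (push _ _ _ aG cG ZG)
  (push _ _ _ aH cH ZH)).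
Qed.

Lemma block_neq0 : blockZ != 0 ->
  (exists i, blockba i != 0) /\ (exists i, blockcb i != 0).
Proof.
move=> Z0; have := block_comm 0 (mH n); rewrite add0n eqxx scale1r => defZ.
have [a0|] := eqVneq (blockba 0) 0; last first.
  move=> a0; split; first by exists 0%N.
  have [c0|] := eqVneq (blockcb (mH n)) 0; last by exists (mH n).
  have [c1|] := eqVneq (blockcb 0) 0; last by exists 0%N.
  by rewrite -defZ c0 c1 !mul0mx subrr eqxx in Z0.
split.
  exists (mH n); apply: contraNneq Z0 => am.
  by rewrite -defZ a0 am !mulmx0 subrr.
exists 0%N; apply: contraNneq Z0 => c0.
by rewrite -defZ a0 c0 mulmx0 mul0mx subrr.
Qed.

End Blocks.

Lemma blockca_eq0 (F : fieldType) (charF0 : [pchar F] =i pred0) n d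
  (R : grep F n d) a b (S : splitting R a b a) i :
  (0 < n)%N -> is_gmod R -> blockca S i = 0.
Proof.
move=> n_gt0 gR; have eqg := blockca_equivariant S n_gt0 gR.
have [//|nz] := eqVneq (blockca S i) 0.
have [k [_ _ _ wk]] := equivariant_highest charF0 eqg nz.
by have := mH_odd n_gt0; lia.
Qed.

(** * Isomorphism of modules with the same socle factors *)

Section Link.
Variables (F : fieldType) (n a b c : nat).

Definition link d d' (R : grep F n d) (R' : grep F n d') (S : splitting R a b c)
    (S' : splitting R' a b c) (x y z : F) : 'M[F]_(d, d') :=
  x *: (Pa S *m Ta S') + y *: (Pb S *m Tb S') + z *: (Pc S *m Tc S').

Lemma T_link d d' (R : grep F n d) (R' : grep F n d') (S : splitting R a b c)
    (S' : splitting R' a b c) x y z :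
  [/\ Ta S *m link S S' x y z = x *: Ta S', Tb S *m link S S' x y z = y *: Tb S' &
      Tc S *m link S S' x y z = z *: Tc S'].
Proof.
have [aa ab ac] := TaP S; have [ba bb bc] := TbP S; have [ca cb cc] := TcP S.
rewrite /link !mulmxDr -!scalemxAr !mulmxA aa ab ac ba bb bc ca cb cc.
by rewrite !mul1mx !mul0mx !scaler0 !addr0 !add0r.
Qed.

Lemma link_inv d d' (R : grep F n d) (R' : grep F n d') (S : splitting R a b c)
    (S' : splitting R' a b c) x y z : x != 0 -> y != 0 -> z != 0 ->
  link S S' x y z *m link S' S x^-1 y^-1 z^-1 = 1%:M.
Proof.
move=> x0 y0 z0; have [a1 b1 c1] := T_link S S' x y z.
have [a2 b2 c2] := T_link S' S x^-1 y^-1 z^-1.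
apply: (splitting_ext (S := S)); rewrite mulmxA mulmx1.
- by rewrite a1 -scalemxAl a2 scalerA mulfV // scale1r.
- by rewrite b1 -scalemxAl b2 scalerA mulfV // scale1r.
by rewrite c1 -scalemxAl c2 scalerA mulfV // scale1r.
Qed.

End Link.

Section Uniqueness.
Variables (F : fieldType) (charF0 : [pchar F] =i pred0) (n a b : nat).
Hypothesis n_gt0 : (0 < n)%N.

Lemma splitting_iso d d' (R : grep F n d) (R' : grep F n d')
    (S : splitting R a b a) (S' : splitting R' a b a) :
  is_gmod R -> is_gmod R' -> faithful R -> faithful R' -> gmod_iso R R'.
Proof.
move=> gR gR' fR fR'.
have Z0 := blockZ_neq0 S n_gt0 gR fR; have Z0' := blockZ_neq0 S' n_gt0 gR' fR'.
have [[i ba0] [j cb0]] := block_neq0 n_gt0 gR Z0.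
have [[i' ba0'] [j' cb0']] := block_neq0 n_gt0 gR' Z0'.
have [s baE] := equivariant_proportional charF0 (blockba_equivariant S n_gt0 gR)
  (blockba_equivariant S' n_gt0 gR') ba0.
have [t cbE] := equivariant_proportional charF0 (blockcb_equivariant S n_gt0 gR)
  (blockcb_equivariant S' n_gt0 gR') cb0.
have s0 : s != 0 by apply: contraNneq ba0' => s0; rewrite baE s0 scale0r.
have t0 : t != 0 by apply: contraNneq cb0' => t0; rewrite cbE t0 scale0r.
have ZE : blockZ S' = (s * t) *: blockZ S.
  have := block_comm S n_gt0 gR 0 (mH n); have := block_comm S' n_gt0 gR' 0 (mH n).
  rewrite add0n eqxx !scale1r => <- <-; rewrite !baE !cbE.
  by rewrite -!scalemxAl -!scalemxAr !scalerA -scalerBr [t * s]mulrC.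
have st0 : s * t != 0 by rewrite mulf_neq0.
(* The scalars 1, t and s t on V(c), V(b) and V(a) accumulate the ratios of the blocks along V(c) ->
   V(b) -> V(a). *)
have [P [Q PQ QP] [aP bP cP]] : exists2 P : 'M_(d, d'),
    exists2 Q : 'M_(d', d), P *m Q = 1%:M & Q *m P = 1%:M &
    [/\ Ta S *m P = (s * t) *: Ta S', Tb S *m P = t *: Tb S' & Tc S *m P = Tc S'].
  exists (link S S' (s * t) t 1); last first.
    by have := T_link S S' (s * t) t 1; rewrite scale1r.
  exists (link S' S (s * t)^-1 t^-1 1^-1); first by rewrite link_inv ?oner_eq0.
  have := link_inv S' S (x := (s * t)^-1) (y := t^-1) (z := 1^-1).
  by rewrite !invrK; apply; rewrite ?invr_eq0 ?oner_eq0.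
have sl2P M M' Ya Yb :
    Ta S *m M = Ya *m Ta S -> Ta S' *m M' = Ya *m Ta S' ->
    Tb S *m M = Yb *m Tb S -> Tb S' *m M' = Yb *m Tb S' ->
    Tc S *m M = Ya *m Tc S -> Tc S' *m M' = Ya *m Tc S' -> M *m P = P *m M'.
  move=> a1 a2 b1 b2 c1 c2; apply: (splitting_ext (S := S)); rewrite !mulmxA.
  - by rewrite a1 -mulmxA aP -scalemxAl a2 -scalemxAr.
  - by rewrite b1 -mulmxA bP -scalemxAl b2 -scalemxAr.
  by rewrite c1 -mulmxA cP c2.
have [aE aG aH] := Ta_sl2 S; have [bE bG bH] := Tb_sl2 S; have [cE cG cH] := Tc_sl2 S.
have [aE' aG' aH'] := Ta_sl2 S'; have [bE' bG' bH'] := Tb_sl2 S'.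
have [cE' cG' cH'] := Tc_sl2 S'.
have PE := sl2P _ _ _ _ aE aE' bE bE' cE cE'.
have PG := sl2P _ _ _ _ aG aG' bG bG' cG cG'.
have PH := sl2P _ _ _ _ aH aH' bH bH' cH cH'.
have PX k : repX R k *m P = P *m repX R' k.
  apply: (splitting_ext (S := S)); rewrite !mulmxA.
  - by rewrite (TaX S) mul0mx aP -scalemxAl (TaX S') scaler0.
  - rewrite (TbX S) bP -mulmxA aP -scalemxAl (TbX S') -/(blockba S k).
    rewrite -/(blockba S' k) baE -scalemxAr -!scalemxAl scalerA.
    by rewrite [t * s]mulrC.
  rewrite (TcX S) cP (TcX S') -/(blockca S k).
  rewrite -/(blockca S' k) !blockca_eq0 // !mul0mx !add0r -mulmxA bP.
  by rewrite -/(blockcb S k) -/(blockcb S' k) cbE -scalemxAr -scalemxAl.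
have PZ : rZ R *m P = P *m rZ R'.
  apply: (splitting_ext (S := S)); rewrite !mulmxA.
  - by rewrite TaZ // mul0mx aP -scalemxAl TaZ // scaler0.
  - by rewrite TbZ // mul0mx bP -scalemxAl TbZ // scaler0.
  by rewrite TcZ // -mulmxA aP cP TcZ // ZE -scalemxAr -scalemxAl.
exists P; split.
- by apply/row_freeP; exists Q.
- by apply/row_fullP; exists Q.
move=> x; rewrite !rhoE !mulmxDl !mulmxDr -!scalemxAl -!scalemxAr PE PG PH PZ.
congr (_ + _ + _); rewrite mulmx_suml mulmx_sumr; apply: eq_bigr => k _.
by rewrite -scalemxAl -scalemxAr PX.
Qed.

End Uniqueness.

Theorem theorem3p1 (F : fieldType) (charF0 : [pchar F] =i pred0)
  (n : nat) (n_gt0 : (0 < n)%N) (d : nat) (R : grep F n d) (a b c : nat) :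
  is_gmod R -> faithful R -> uniserial3 R a b c ->
  [/\ c = a,
      n = 1%N -> b = a.+1 \/ ((1 <= a)%N /\ b = a.-1),
      (2 <= n)%N ->
        [\/ (a, b) = (0%N, mH n), (a, b) = (1%N, (mH n).+1),
            (a, b) = (1%N, (mH n).-1) | mH n = 3%N /\ (a, b) = (4%N, 3%N)] &
      forall (d' : nat) (R' : grep F n d'),
        is_gmod R' -> faithful R' -> uniserial3 R' a b c -> gmod_iso R R'].
Proof.
move=> gR fR uR.
have split_of e (T : grep F n e) : is_gmod T -> faithful T ->
    uniserial3 T a b c -> inhabited (splitting T a b c).
  (* In dimension 0 all matrices are equal, so no representation is faithful. *)
  case: e T => [|e] T gT fT; last exact: uniserial3_splitting.
  have : GElt 0 0 0 0 (1 : F) = GElt 0 0 0 0 0 :> gelt F n.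
    by apply: fT; rewrite [LHS]thinmx0 [RHS]thinmx0.
  by case=> /eqP; rewrite oner_eq0.
have [S] := split_of _ _ gR fR uR.
have Z0 := blockZ_neq0 S n_gt0 gR fR.
have ca := blockZ_ends charF0 n_gt0 gR Z0; subst c.
have [[i ba0] [j cb0]] := block_neq0 n_gt0 gR Z0.
have [k [r [le_km ar wk sum_const]]] := commutator_coupling charF0 (mH_odd n_gt0)
  (blockba_equivariant S n_gt0 gR) (blockcb_equivariant S n_gt0 gR)
  (block_comm S n_gt0 gR) ba0 cb0.
split=> // [n1|n_ge2|d' R' gR' fR' uR'].
- subst n; rewrite /mH /= in le_km wk.
  (* For m = 1 only k = 0 and k = 1 are possible, and in the second case a = 1 + r is positive. *)
  by case: k le_km ar wk {sum_const} => [|[|k]] // _ ar wk; [left|right]; lia.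
- have m_ge3 : (3 <= mH n)%N by rewrite /mH; lia.
  have [] := diag_weight_sum_const (mH_odd n_gt0) m_ge3 le_km sum_const.
  + by case=> k0 r0; constructor 1; congr pair; lia.
  + by case=> k0 r1; constructor 2; congr pair; lia.
  + by case=> k1 r0; constructor 3; congr pair; lia.
  by case=> m3 k2 r2; constructor 4; split=> //; congr pair; lia.
have [S'] := split_of _ _ gR' fR' uR'.
exact: (splitting_iso charF0 n_gt0 S S').
Qed.
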